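(* Every $7$-tough $(P_4\cup P_1)$-free graph on at least three vertices is Hamiltonian.
   Context: All graphs are finite and simple. A graph is Hamiltonian if it contains a spanning cycle. $P_4\cup P_1$ denotes the disjoint union of a path on four vertices and a single isolated vertex; a graph is $H$-free if it contains no induced subgraph isomorphic to $H$. For a graph $G$ and $X\subseteq V(G)$, let $c(G-X)$ denote the number of connected components of $G-X$. The toughness of $G$ is $\tau(G)=\min\{|X|/c(G-X): X\subseteq V(G),\ c(G-X)\ge 2\}$, with $\tau(G)=\infty$ if $G$ is complete. For a real number $t\ge0$, $G$ is $t$-tough if $\tau(G)\ge t$. *)

(* Defs.v *)
From mathcomp Require Import all_boot all_order all_algebra.
From mathcomp Require Import reals constructive_ereal.

Set Implicit Arguments.
Unset Strict Implicit.
Unset Printing Implicit Defensive.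

Import Order.TTheory GRing.Theory Num.Theory.

Record sgraph := SGraph {
  vertex :> finType;
  adj : rel vertex;
  adj_sym : symmetric adj;
  adj_irr : irreflexive adj
}.

Arguments adj {G} : rename.

Section PathGraph.
Variable n : nat.

Definition path_adj : rel 'I_n :=
  fun i j => (i.+1 == j :> nat) || (j.+1 == i :> nat).

Fact path_adj_sym : symmetric path_adj.
Proof. by move=> i j; rewrite /path_adj orbC. Qed.

Fact path_adj_irr : irreflexive path_adj.
Proof. by move=> i; rewrite /path_adj orbb gtn_eqF. Qed.

(* n counts vertices *)
Definition path_graph : sgraph := SGraph path_adj_sym path_adj_irr.
End PathGraph.

Section DisjointUnion.
Variables G H : sgraph.

Definition dunion_adj : rel (G + H)%type := fun u v =>
  match u, v with
  | inl x, inl y => adj x y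
  | inr x, inr y => adj x y
  | _, _ => false
  end.

Fact dunion_adj_sym : symmetric dunion_adj.
Proof. by move=> [x|x] [y|y] //=; rewrite adj_sym. Qed.

Fact dunion_adj_irr : irreflexive dunion_adj.
Proof. by move=> [x|x] /=; rewrite adj_irr. Qed.

Definition dunion : sgraph := SGraph dunion_adj_sym dunion_adj_irr.
End DisjointUnion.

Section InducedSubgraph.
Variables (G : sgraph) (A : {set G}).

Definition induced_adj : rel {x : G | x \in A} :=
  fun u v => adj (val u) (val v).

Fact induced_adj_sym : symmetric induced_adj.
Proof. by move=> u v; apply: adj_sym. Qed.

Fact induced_adj_irr : irreflexive induced_adj.
Proof. by move=> u; apply: adj_irr. Qed.

Definition induced : sgraph := SGraph induced_adj_sym induced_adj_irr.
End InducedSubgraph.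

Definition isomorphic (G H : sgraph) : Prop :=
  exists2 f : G -> H, bijective f & {mono f : x y / adj x y}.

Definition induced_free (H G : sgraph) : Prop :=
  forall A : {set G}, ~ isomorphic (induced A) H.

Definition P4_P1 : sgraph := dunion (path_graph 4) (path_graph 1).

(* [ucycle] accepts the sequences of size 0 and, for an edge xy, [:: x; y];
   neither is a cycle of a simple graph, hence the bound on the size. *)
Definition hamiltonian (G : sgraph) : Prop :=
  exists c : seq G, [/\ 2 < size c, ucycle adj c & forall x : G, x \in c].

Definition is_complete (G : sgraph) : bool :=
  [forall x : G, forall y : G, (x != y) ==> adj x y].

Definition ncomponents (G : sgraph) : nat := n_comp (@adj G) G.

Definition ncomponents_del (G : sgraph) (X : {set G}) : nat :=
  ncomponents (induced (~: X)).

(* When G is not complete the minimum ranges over a nonempty family (delete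
   all vertices but two nonadjacent ones), so its default value +oo is never
   the result. *)
Definition toughness (R : realType) (G : sgraph) : \bar R :=
  if is_complete G then +oo%E
  else \big[Order.min/+oo%E]_(X : {set G} | 2 <= ncomponents_del X)
         (#|X|%:R / (ncomponents_del X)%:R)%:E.

Definition tough (R : realType) (t : R) (G : sgraph) : Prop :=
  (t%:E <= toughness R G)%E.

(* Main.v *)
(* Choose S with k >= 2 components left in G - S so that (3k - |S|, k) is
   lexicographically maximal; 7-toughness gives |S| >= 7k.  Each component of
   G - S is P4-free, since a vertex of another component is anticomplete to it,
   and by maximality it is so tough that it has a Hamiltonian path between any
   two of its vertices.  Also by maximality, all but 3k - 5 vertices of S can be
   used to leave a component after entering it from a given vertex, so a greedy
   choice of k connecting vertices in S yields a cycle through all of G - S.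

   Let C be a longest such cycle, suppose that it is not spanning, let H be a
   component of G - C and W the set of neighbours of H on C.  As C is longest, no
   path spans C and has both ends in W.  The pieces of C between consecutive
   vertices of W partition the P4-free set C - W.  Decomposing that set as a
   cograph, one finds a set X such that (C - W) - X has at least |X| + |W|
   components: otherwise two pieces could be merged into one path, giving a
   forbidden spanning path of C.  Removing W, X and the at most |S| vertices of
   G - C - H leaves at least |X| + |W| + 1 components, so 6|W| + 7 <= |S|,
   whereas maximality compared with the cut W gives |S| + 6 <= |W| + 3k, where
   7k <= |S|: a contradiction. *)
Require Import Defs.
From mathcomp Require Import all_boot all_order all_algebra.
From mathcomp Require Import reals constructive_ereal.
From mathcomp Require Import zify boolp.

Set Implicit Arguments.
Unset Strict Implicit.
Unset Printing Implicit Defensive.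

Import Order.TTheory GRing.Theory Num.Theory.

(** * Merging two paths *)

Section Walks.
Variables (T : eqType).
Implicit Types (e : rel T) (x y : T) (s p q : seq T).

(** Both ends are explicit, so that concatenation and reversal only have to track ends. Repeated
    vertices are allowed: distinctness is recorded apart, by [uniq] or [perm_eq]. *)
Definition walk e x y s :=
  if s is z :: q then [&& z == x, last z q == y & path e z q] else false.

Lemma walk1 e x : walk e x x [:: x].
Proof. by rewrite /walk /= !eqxx. Qed.

Lemma walk_neq0 e x y s : walk e x y s -> s != [::].
Proof. by case: s. Qed.

Lemma walk_head e x y s : walk e x y s -> x \in s.
Proof. by case: s => // z q /and3P[/eqP-> _ _]; rewrite mem_head. Qed.

Lemma walk_last e x y s : walk e x y s -> y \in s.
Proof. by case: s => // z q /and3P[_ /eqP<- _]; rewrite mem_last. Qed.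

Lemma walk_cat e x y z t s q :
  walk e x y s -> walk e z t q -> e y z -> walk e x t (s ++ q).
Proof.
case: s q => // a s [] // b q /and3P[/eqP-> /eqP sy ps] /and3P[/eqP-> qt pq] yz.
by rewrite /walk /= eqxx last_cat /= qt cat_path ps /= sy yz.
Qed.

Lemma walk_cons e x y z s : walk e y z s -> e x y -> walk e x z (x :: s).
Proof. by move=> h exy; apply: (walk_cat (walk1 e x) h). Qed.

Lemma walk_split e x t s q : walk e x t (s ++ q) -> s != [::] -> q != [::] ->
  exists y z, [/\ walk e x y s, walk e z t q & e y z].
Proof.
case: s q => // a s [] // b q; rewrite /walk /= last_cat cat_path /=.
case/and3P=> -> -> /and3P[-> eab ->] _ _.
by exists (last a s), b; rewrite !eqxx.
Qed.

Lemma walk_rev e x y s : symmetric e -> walk e x y s -> walk e y x (rev s).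
Proof.
move=> esym; elim: s x => // a [|b s] IH x.
  by case/and3P=> /eqP <- /eqP <- _; rewrite walk1.
case/and3P=> /eqP-> sy /= /andP[xb pbs].
rewrite rev_cons -cats1; apply: (walk_cat (IH b _) (walk1 _ _)).
  by rewrite /walk eqxx sy.
by rewrite esym.
Qed.

Lemma sub_walk e e' x y s : subrel e e' -> walk e x y s -> walk e' x y s.
Proof. by move=> ee'; case: s => // a s; rewrite /walk => /and3P[-> -> /(sub_path ee')]. Qed.

Lemma walk_inj e e' x x' y y' s :
  walk e x y s -> walk e' x' y' s -> x = x' /\ y = y'.
Proof. by case: s => // a s /and3P[/eqP<- /eqP<- _] /and3P[/eqP<- /eqP<- _]. Qed.

End Walks.

Section Merging.
Variables (T : eqType) (e : rel T).
Hypothesis e_sym : symmetric e.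
Implicit Types (x y : T) (p q : seq T) (ps : seq (seq T)).

(* The two pairings of an initial vertex with the final vertex of the other
   path are excluded on purpose: when p and q are the pieces of a cycle between
   separating vertices, only the four pairings below turn the rest of the cycle
   and the merged path into a single path. *)
Definition mergeable p q := exists s x y z t,
  [/\ perm_eq s (p ++ q), walk e x y p, walk e z t q &
      [\/ walk e x y s, walk e z t s, walk e x z s | walk e y t s]].

Definition unmergeable ps := {in ps &, forall p q, p != q -> ~ mergeable p q}.

Lemma mergeable_sym p q : mergeable p q -> mergeable q p.
Proof.
case=> s [x [y [z [t [sE wp wq ws]]]]].
have sE' : perm_eq s (q ++ p) by rewrite (perm_trans sE) // perm_catC.
have sE'' : perm_eq (rev s) (q ++ p) by rewrite perm_rev.
case: ws => ws; [exists s|exists s|exists (rev s)|exists (rev s)];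
  exists z, t, x, y; split=> //.
- exact: Or42.
- exact: Or41.
- by apply: Or43; apply: walk_rev.
- by apply: Or44; apply: walk_rev.
Qed.

Lemma mergeable_rev p q : mergeable p q -> mergeable (rev p) (rev q).
Proof.
case=> s [x [y [z [t [sE wp wq ws]]]]].
have sE' : perm_eq s (rev p ++ rev q).
  by rewrite (perm_trans sE) // -rev_cat perm_sym perm_rev perm_catC.
case: ws => ws; [exists (rev s)|exists (rev s)|exists s|exists s];
  exists y, x, t, z; split=> //; rewrite ?perm_rev //; try exact: walk_rev.
- by apply: Or41; apply: walk_rev.
- by apply: Or42; apply: walk_rev.
- exact: Or44.
- exact: Or43.
Qed.

(** Both ends of the merged path of [p1] and [q] are neighbours of [b], so [b :: p2] can be hung on
    either. With [v] the last vertex of [p2], a suitable choice leaves the ends [x], [v] or [v],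
    [t], again an allowed pairing. *)
Lemma mergeable_extend_left p1 b p2 q : mergeable p1 q ->
  (forall x y, walk e x y p1 -> e b x /\ e b y) ->
  (forall x y, walk e x y q -> e b x /\ e b y) ->
  (exists x y, walk e x y p2 /\ e b x) -> mergeable (p1 ++ b :: p2) q.
Proof.
case=> s [x [y [z [t [sE wp wq ws]]]]] b1 bq [u [v [w2 bu]]].
have [bx by_] := b1 _ _ wp; have [bz bt] := bq _ _ wq.
have wb : walk e b v (b :: p2) by apply: walk_cons w2 bu.
have wP : walk e x v (p1 ++ b :: p2) by apply: walk_cat wp wb _; rewrite e_sym.
have pE : perm_eq (s ++ b :: p2) ((p1 ++ b :: p2) ++ q).
  by rewrite perm_sym perm_catAC perm_cat2r perm_sym.
case: ws => ws.
- exists (s ++ b :: p2), x, v, z, t; split=> //.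
  by apply: Or41; apply: walk_cat ws wb _; rewrite e_sym.
- exists (rev (b :: p2) ++ s), x, v, z, t; split=> //.
    by rewrite (perm_trans _ pE) // perm_catC perm_cat2l perm_rev.
  by apply: Or44; apply: walk_cat (walk_rev e_sym wb) ws _.
- exists (s ++ b :: p2), x, v, z, t; split=> //.
  by apply: Or41; apply: walk_cat ws wb _; rewrite e_sym.
- exists (rev (b :: p2) ++ s), x, v, z, t; split=> //.
    by rewrite (perm_trans _ pE) // perm_catC perm_cat2l perm_rev.
  by apply: Or44; apply: walk_cat (walk_rev e_sym wb) ws _.
Qed.

Lemma mergeable_extend_right p1 b p2 q : mergeable p2 q ->
  (forall x y, walk e x y p2 -> e b x /\ e b y) ->
  (forall x y, walk e x y q -> e b x /\ e b y) ->
  (exists x y, walk e x y p1 /\ e b y) -> mergeable (p1 ++ b :: p2) q.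
Proof.
have brev p : (forall x y, walk e x y p -> e b x /\ e b y) ->
              forall x y, walk e x y (rev p) -> e b x /\ e b y.
  by move=> h x y /(walk_rev e_sym); rewrite revK => /h[].
move=> /mergeable_rev m /brev b2 /brev bq [x [y [w1 by_]]].
rewrite -[q]revK -[p1 ++ _]revK rev_cat rev_cons cat_rcons.
apply/mergeable_rev/mergeable_extend_left => //.
by exists y, x; split; rewrite // walk_rev.
Qed.

(** One end of the merged path of [p1] and [p2] is the first vertex of [p1] or the last vertex of
    [p2], hence an end of [p1 ++ b :: p2]. From the other end the path goes on through [b] into [q],
    in the direction that leaves an allowed pairing. *)
Lemma mergeable_join p1 b p2 q : mergeable p1 p2 ->
  (forall p, p \in [:: p1; p2; q] ->
     forall x y, walk e x y p -> e b x /\ e b y) ->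
  (exists x y, walk e x y q) -> mergeable (p1 ++ b :: p2) q.
Proof.
case=> s [x [y [z [t [sE w1 w2 ws]]]]] bE [u [v wq]].
have [bx by_] : e b x /\ e b y by apply: (bE p1); rewrite ?inE ?eqxx.
have [bz bt] : e b z /\ e b t by apply: (bE p2); rewrite ?inE ?eqxx ?orbT.
have [bu bv] : e b u /\ e b v by apply: (bE q); rewrite ?inE ?eqxx ?orbT.
have wP : walk e x t (p1 ++ b :: p2).
  by apply: walk_cat w1 (walk_cons w2 bz) _; rewrite e_sym.
have pE s' r : perm_eq s' s -> perm_eq r q ->
    perm_eq (s' ++ b :: r) ((p1 ++ b :: p2) ++ q).
  move=> ss rq; apply/permP=> a; rewrite !count_cat /=.
  by rewrite (permP rq) (permP ss) (permP sE) count_cat; lia.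
have wr : walk e b u (b :: rev q) by apply: walk_cons (walk_rev e_sym wq) bv.
have wf : walk e b v (b :: q) by apply: walk_cons wq bu.
case: ws => ws.
- exists (s ++ b :: rev q), x, t, u, v; split; rewrite ?pE ?perm_rev //.
  by apply: Or43; apply: walk_cat ws wr _; rewrite e_sym.
- exists (rev s ++ b :: q), x, t, u, v; split; rewrite ?pE ?perm_rev //.
  by apply: Or44; apply: walk_cat (walk_rev e_sym ws) wf _; rewrite e_sym.
- exists (s ++ b :: rev q), x, t, u, v; split; rewrite ?pE ?perm_rev //.
  by apply: Or43; apply: walk_cat ws wr _; rewrite e_sym.
- exists (rev s ++ b :: q), x, t, u, v; split; rewrite ?pE ?perm_rev //.
  by apply: Or44; apply: walk_cat (walk_rev e_sym ws) wf _; rewrite e_sym.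
Qed.

(** A merge involving [p1] or [p2] would extend through [b] to a merge of [p1 ++ b :: p2] with
    another path. If [p1] and [p2] merge with each other, any third path will do, whence the
    condition on [l1 ++ l2]. *)
Lemma unmergeable_split l1 p1 b p2 l2 :
  0 < size (l1 ++ l2) -> uniq (flatten (l1 ++ (p1 ++ b :: p2) :: l2)) ->
  {in p1 :: p2 :: l1 ++ l2, forall p,
     exists x y, [/\ walk e x y p, e b x & e b y]} ->
  unmergeable (l1 ++ (p1 ++ b :: p2) :: l2) ->
  unmergeable (l1 ++ p1 :: p2 :: l2).
Proof.
move=> szl unq bE um.
have memE p : (p \in l1 ++ p1 :: p2 :: l2) = (p \in p1 :: p2 :: l1 ++ l2).
  by rewrite !(in_cons, mem_cat); case: (p == p1); case: (p == p2); rewrite ?orbT.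
have bE' p : p \in p1 :: p2 :: l1 ++ l2 ->
    forall x y, walk e x y p -> e b x /\ e b y.
  by move=> /bE[x [y [w bx by_]]] x' y' /(walk_inj w)[<- <-].
have wE p : p \in p1 :: p2 :: l1 ++ l2 -> exists x y, walk e x y p.
  by move=> /bE[x [y []]]; exists x, y.
have inP : p1 ++ b :: p2 \in l1 ++ (p1 ++ b :: p2) :: l2.
  by rewrite mem_cat mem_head orbT.
have inl q : q \in l1 ++ l2 -> q \in l1 ++ (p1 ++ b :: p2) :: l2.
  by rewrite !mem_cat inE => /orP[]->; rewrite ?orbT.
have nP q : q \in l1 ++ l2 -> p1 ++ b :: p2 != q.
  move=> ql; apply/eqP=> qE; move: unq.
  have /perm_flatten/perm_uniq-> : perm_eq (l1 ++ (p1 ++ b :: p2) :: l2)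
                                    ((p1 ++ b :: p2) :: l1 ++ l2).
    by rewrite perm_catC /= perm_cons perm_catC.
  rewrite /= cat_uniq => /and3P[_ /hasP[]]; exists b.
    by apply/flattenP; exists q => //; rewrite -qE mem_cat mem_head orbT.
  by rewrite mem_cat mem_head orbT.
have no12 : ~ mergeable p1 p2.
  have [q ql] : exists q, q \in l1 ++ l2.
    by case: (l1 ++ l2) szl => // q l _; exists q; rewrite mem_head.
  move=> m; apply: (um _ _ inP (inl q ql) (nP q ql)); apply: mergeable_join m _ _.
    by move=> p; rewrite !inE => /or3P[]/eqP->; apply: bE'; rewrite !inE ?eqxx ?ql ?orbT.
  by apply: wE; rewrite !inE ql !orbT.
have no1 q : q \in l1 ++ l2 -> ~ mergeable p1 q.
  move=> ql m; apply: (um _ _ inP (inl q ql) (nP q ql)).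
  apply: mergeable_extend_left m _ _ _.
  - by apply: bE'; rewrite !inE eqxx.
  - by apply: bE'; rewrite !inE ql !orbT.
  - have [|x [y [w bx _]]] := bE p2; first by rewrite !inE eqxx orbT.
    by exists x, y.
have no2 q : q \in l1 ++ l2 -> ~ mergeable p2 q.
  move=> ql m; apply: (um _ _ inP (inl q ql) (nP q ql)).
  apply: mergeable_extend_right m _ _ _.
  - by apply: bE'; rewrite !inE eqxx orbT.
  - by apply: bE'; rewrite !inE ql !orbT.
  - have [|x [y [w _ by_]]] := bE p1; first by rewrite !inE eqxx.
    by exists x, y.
move=> p q; rewrite !memE !in_cons.
case/or3P=> [/eqP->|/eqP->|pl] /or3P[/eqP->|/eqP->|ql] pq m.
- by rewrite eqxx in pq.
- exact: no12 m.
- exact: no1 q ql m.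
- by apply: no12; apply: mergeable_sym.
- by rewrite eqxx in pq.
- exact: no2 q ql m.
- by apply: (no1 p) => //; apply: mergeable_sym.
- by apply: (no2 p) => //; apply: mergeable_sym.
- by apply: (um p q) => //; apply: inl.
Qed.

End Merging.

(** Induction on the number of entries satisfying [a]: each cut deletes one of them and adds one
    piece. It serves both for the sides of a join and for the separating vertices of a cycle. *)
Lemma split_pieces (T : eqType) (a : pred T) (Phi : seq (seq T) -> Prop) :
  (forall l1 p1 b p2 l2, a b -> Phi (l1 ++ (p1 ++ b :: p2) :: l2) ->
     Phi (l1 ++ p1 :: p2 :: l2)) ->
  forall ps, Phi ps -> exists ps',
    [/\ Phi ps', flatten ps' = filter (predC a) (flatten ps) &
        size ps' = size ps + count a (flatten ps)].
Proof.
move=> step ps; move: {2}(count a _) (erefl (count a (flatten ps))) => n.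
elim: n ps => [|n IH] ps cE Pps.
  exists ps; split; rewrite ?cE ?addn0 //; apply/esym/all_filterP.
  by rewrite all_predC has_count cE.
have /hasP[b /flattenP[p pps bp] ab] : has a (flatten ps) by rewrite has_count cE.
case/splitPr: bp pps => p1 p2 /path.splitPr pps.
case: pps cE Pps => l1 l2 cE /(step _ _ _ _ _ ab) Pps.
have cE' : count a (flatten (l1 ++ p1 :: p2 :: l2)) = n.
  by move: cE; rewrite !flatten_cat /= -!catA !count_cat /= ab; lia.
have [ps' [Pps' fE sE]] := IH _ cE' Pps.
exists ps'; split=> //.
  by rewrite fE !flatten_cat /= -!catA !filter_cat /= ab.
by rewrite sE cE cE' !size_cat /=; lia.
Qed.

(** * P4-free sets *)

Section Cographs.
Variables (V : finType).
Implicit Types (e : rel V) (A B K X : {set V}) (ps qs : seq (seq V)).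

(** Distinctness need not be required: for symmetric irreflexive [e], a coincidence among the four
    vertices of such a walk makes one of the three chords hold. *)
Definition P4_free e K := {in K &, forall a b, {in K &, forall c d,
  e a b -> e b c -> e c d -> [|| e a c, e a d | e b d]}}.

Definition anticomplete e A B := {in A & B, forall x y, ~~ e x y}.

(** Disconnectedness of [K]; for [co e] it says that [K] is the join of two nonempty sets. *)
Definition splits e K := exists A B,
  [/\ A :|: B = K, [disjoint A & B], A != set0, B != set0 & anticomplete e A B].

Definition co e : rel V := fun x y => (x != y) && ~~ e x y.

Lemma sub_P4_free e A B : A \subset B -> P4_free e B -> P4_free e A.
Proof. by move=> /subsetP AB PB a b /AB aB /AB bB c d /AB cB /AB; apply: PB. Qed.

Lemma co_sym e : symmetric e -> symmetric (co e).
Proof. by move=> es x y; rewrite /co eq_sym es. Qed.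

(** An induced path a b c d of the complement is the induced path c a d b of [e]. *)
Lemma P4_free_co e K : symmetric e -> P4_free e K -> P4_free (co e) K.
Proof.
move=> es PK a b aK bK c d cK dK; rewrite /co.
move=> /andP[ab eab] /andP[bc ebc] /andP[cd ecd].
apply: contraT; rewrite !negb_or !negb_and !negbK => /and3P[ac ad bd].
case/orP: ac => [/eqP ac|ac].
  case/orP: ad => [/eqP ad|ad]; first by rewrite -ac -ad eqxx in cd.
  by rewrite -ac ad in ecd.
case/orP: ad => [/eqP ad|ad]; first by rewrite -ad es ac in ecd.
case/orP: bd => [/eqP bd|bd]; first by rewrite bd ad in eab.
have := PK c a cK aK d b dK bK; rewrite (es c a) (es d b) => /(_ ac ad bd).
by rewrite (negPf ecd) (es c) (negPf ebc) (negPf eab).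
Qed.

(** If [v] is complete to the rest, [K] is a join. Otherwise [v] misses a vertex of one side, say
    [A]; then either [v] has no neighbour in [B] and [B] splits off, or the nonneighbours of [v] in
    [A] do. *)
Lemma splits_add e K v : symmetric e -> P4_free e K -> v \in K ->
  splits e (K :\ v) -> splits e K \/ splits (co e) K.
Proof.
move=> es PK vK [A [B [ABK dAB A0 B0 nAB]]].
have AK x : x \in A -> (x \in K) && (x != v).
  by move=> xA; have /setP/(_ x) := ABK; rewrite !inE xA andbC.
have BK x : x \in B -> (x \in K) && (x != v).
  by move=> xB; have /setP/(_ x) := ABK; rewrite !inE xB orbT andbC.
have KE x : x \in K = [|| x == v, x \in A | x \in B].
  have /setP/(_ x) := ABK; rewrite !inE => ->.
  by case: eqVneq => //= ->.
wlog vxA : A B ABK dAB A0 B0 nAB AK BK KE / exists2 y, y \in A & ~~ e v y.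
  move=> WL; have [/exists_inP[y yA vy]|nA] := boolP [exists y in A, ~~ e v y].
    by apply: (WL A B) => //; exists y.
  have [/exists_inP[y yB vy]|nB] := boolP [exists y in B, ~~ e v y].
    apply: (WL B A) => //; first by rewrite setUC.
    - by rewrite disjoint_sym.
    - by move=> x z xB zA; rewrite es; apply: nAB.
    - by move=> x; rewrite KE; case: (x \in A); rewrite ?orbT ?orbF.
    - by exists y.
  right; exists [set v], (K :\ v); split; rewrite ?setD1K //.
  - by rewrite disjoints1 !inE eqxx.
  - by apply/set0Pn; exists v; rewrite inE.
  - by case/set0Pn: A0 => x /AK/andP[xK xv]; apply/set0Pn; exists x; rewrite !inE xv.
  move=> x y; rewrite !inE => /eqP-> /andP[yv]; rewrite KE (negPf yv) /= /co.
  move: nA nB; rewrite !negb_exists_in => /forall_inP nA /forall_inP nB.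
  by case/orP=> [/nA|/nB]; rewrite negb_and !negbK => ->; rewrite orbT.
have dA x : x \in A -> x \notin B by move=> xA; rewrite (disjointFr dAB).
left; have [y yA vy] := vxA.
have [/exists_inP[z zB vz]|nB] := boolP [exists z in B, e v z]; last first.
  exists B, (v |: A); split=> //.
  - by apply/setP=> x; rewrite KE !inE orbCA (orbC (x \in B)).
  - rewrite disjoint_sym; apply/pred0P=> x; rewrite /= !inE.
    apply/negP=> /andP[/orP[/eqP->|xA xB]].
      by move/BK; rewrite eqxx andbF.
    by move/negP: (dA x xA).
  - by apply/set0Pn; exists v; rewrite !inE eqxx.
  move=> x u xB; rewrite !inE => /orP[/eqP->|uA]; last by rewrite es nAB.
  by apply: contra nB => exv; apply/exists_inP; exists x; rewrite // es.
(* An edge between [u] in [A2] and [x] in [A1] would give the induced path z v x u. *)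
pose A1 := [set x in A | e v x]; pose A2 := [set x in A | ~~ e v x].
exists A2, (K :\: A2); split.
- apply/setP=> x; rewrite !inE KE; case: (x \in A) => //=; rewrite ?andbT ?orbT //.
  by case: (e v x).
- by rewrite disjoint_sym disjoints_subset setDE subsetIr.
- by apply/set0Pn; exists y; rewrite inE yA.
- by apply/set0Pn; exists v; rewrite inE vK andbT inE negb_and; apply/orP; left;
    apply/negP=> /AK; rewrite eqxx andbF.
move=> u x; rewrite inE => /andP[uA vu]; rewrite !inE KE negb_and negbK.
case/andP=> h /or3P[/eqP xv|xA|xB]; last by rewrite nAB.
  by rewrite xv es.
move: h; rewrite xA /= => vx; apply/negP=> eux.
have /andP[uK _] := AK u uA; have /andP[xK _] := AK x xA; have /andP[zK _] := BK z zB.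
have := PK z v zK vK x u xK uK; rewrite es vz vx es eux => /(_ isT isT isT).
by rewrite (es z x) (negPf (nAB x z xA zB)) (es z u) (negPf (nAB u z uA zB)) (negPf vu).
Qed.

(* Seinsche's theorem; P4 being self-complementary, adding a vertex needs to be
   discussed only when what remains is disconnected. *)
Lemma P4_free_splits e K : symmetric e -> irreflexive e -> P4_free e K ->
  1 < #|K| -> splits e K \/ splits (co e) K.
Proof.
move=> es ei; move: {2}#|K| (leqnn #|K|) => n; elim: n K => [|n IH] K; first by lia.
move=> Kn PK K1; have /card_gt0P[v vK] : 0 < #|K| by lia.
have KvE := cardsD1 v K; rewrite vK in KvE.
have PKv : P4_free e (K :\ v) by apply: sub_P4_free PK; rewrite subsetDl.
have [Kv1|Kv1] := ltnP 1 #|K :\ v|.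
  case: (IH (K :\ v)) => // [|h|h]; first by lia.
    exact: splits_add h.
  have := splits_add (co_sym es) (P4_free_co es PK) vK h.
  case=> [|[A [B [? ? ? ? cAB]]]]; [by right | left].
  exists A, B; split=> // x y xA yB; have := cAB x y xA yB.
  rewrite /co negb_and !negbK; case: eqP => [->|_] /=; first by rewrite ei.
  by case: (x =P y) => [->|_] //=; rewrite ?ei // negbK.
have /cards1P[u uE] : #|K :\ v| == 1 by lia.
have /setD1P[uv _] : u \in K :\ v by rewrite uE inE.
have KE : [set v] :|: [set u] = K by rewrite -uE setD1K.
have dvu : [disjoint [set v] & [set u]] by rewrite disjoints1 inE eq_sym.
have n0 x : [set x] != set0 :> {set V} by apply/set0Pn; exists x; rewrite inE.
have [euv|euv] := boolP (e v u); [right|left]; exists [set v], [set u];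
  split=> // x y; rewrite !inE => /eqP-> /eqP-> //.
by rewrite /co euv andbF.
Qed.

(* K has at least m connected components: it has a colouring which is constant
   along edges and uses all colours below m. *)
Definition ge_comps e m K := exists f : V -> nat,
  {in K &, forall x y, e x y -> f x = f y} /\
  forall i, i < m -> exists2 x, x \in K & f x = i.

Lemma ge_comps0 e : ge_comps e 0 set0.
Proof. by exists (fun=> 0). Qed.

Lemma ge_comps1 e K : K != set0 -> ge_comps e 1 K.
Proof.
by case/set0Pn=> x xK; exists (fun=> 0); split=> // -[] // _; exists x.
Qed.

Lemma ge_comps_le e m n K : m <= n -> ge_comps e n K -> ge_comps e m K.
Proof.
by move=> mn [f [fe fK]]; exists f; split=> // i im; apply: fK; apply: leq_trans mn.
Qed.

Lemma ge_compsU e m n A B : symmetric e -> [disjoint A & B] -> anticomplete e A B ->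
  ge_comps e m A -> ge_comps e n B -> ge_comps e (m + n) (A :|: B).
Proof.
move=> es dAB nAB [f [fe fK]] [g [ge gK]].
have BA x : x \in B -> x \in A = false by move=> xB; rewrite (disjointFl dAB).
exists (fun x => if x \in A then f x else m + g x); split.
  move=> x y; rewrite !inE; case: (boolP (x \in A)) => [xA _|_ /= xB];
    case: (boolP (y \in A)) => [yA _|_ /= yB] exy.
  - exact: fe.
  - by move: (nAB x y xA yB); rewrite exy.
  - by move: (nAB y x yA xB); rewrite es exy.
  - by rewrite (ge x y).
move=> i imn; have [im|mi] := ltnP i m.
  by have [x xA fx] := fK i im; exists x; rewrite ?inE xA.
have [|x xB gx] := gK (i - m); first by lia.
by exists x; rewrite ?inE ?xB ?orbT // BA // gx; lia.
Qed.

Lemma walk_side e A B x y p : symmetric e -> anticomplete e A B ->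
  {subset p <= A :|: B} -> walk e x y p -> {subset p <= A} \/ {subset p <= B}.
Proof.
move=> es nAB; elim: p x => // a [|b p] IH x sp.
  have := sp a (mem_head _ _); rewrite inE => /orP[aA|aB] _; [left|right] => z;
    by rewrite inE => /eqP->.
case/and3P=> _ sy /= /andP[eab pbp].
have {}IH := IH b _ _; case: IH.
- by move=> z zp; apply: sp; rewrite inE zp orbT.
- by rewrite /walk eqxx sy.
- move=> pA; left=> z; rewrite inE => /orP[/eqP->|/pA//].
  have := sp a (mem_head _ _); rewrite inE => /orP[//|aB].
  by have := nAB b a (pA b (mem_head _ _)) aB; rewrite es eab.
- move=> pB; right=> z; rewrite inE => /orP[/eqP->|/pB//].
  have := sp a (mem_head _ _); rewrite inE => /orP[aA|//].
  by have := nAB a b aA (pB b (mem_head _ _)); rewrite eab.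
Qed.

(** * Partitions of a set into paths *)

Definition pathlist e (ps : seq (seq V)) := {in ps, forall p, exists x y, walk e x y p}.

Definition path_partition e K ps :=
  [/\ uniq (flatten ps), flatten ps =i K & pathlist e ps].

Lemma path_partition_perm e K ps qs : perm_eq ps qs ->
  path_partition e K ps -> path_partition e K qs.
Proof.
move=> pq [u m w]; split.
- by rewrite -(perm_uniq (perm_flatten pq)).
- by move=> x; rewrite -m (perm_mem (perm_flatten pq)).
- by move=> p; rewrite -(perm_mem pq); apply: w.
Qed.

Lemma path_partition_size e K ps : path_partition e K ps -> size ps <= #|K|.
Proof.
case=> u m w; rewrite -(eq_card m) (card_uniqP u).
elim: ps w {u m} => //= p ps IH w; rewrite size_cat.
have /IH: pathlist e ps by move=> q qps; apply: w; rewrite inE qps orbT.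
have [x [y /walk_neq0]] := w p (mem_head _ _).
by case: p {w} => //= a p _; lia.
Qed.

Lemma path_partition_side e A B ps : symmetric e -> anticomplete e A B ->
  [disjoint A & B] -> path_partition e (A :|: B) ps ->
  exists qs rs : seq (seq V),
    [/\ perm_eq ps (qs ++ rs), path_partition e A qs & path_partition e B rs].
Proof.
move=> es nAB dAB [u m w]; pose a (p : seq V) := all (mem A) p.
have pq : perm_eq ps (filter a ps ++ filter (predC a) ps).
  by rewrite perm_sym perm_filterC.
exists (filter a ps), (filter (predC a) ps); split=> //.
all: have := u; rewrite (perm_uniq (perm_flatten pq)) flatten_cat cat_uniq => /and3P[u1 _ u2].
all: split=> //.
2,4: by move=> p; rewrite mem_filter => /andP[_ /w].
  move=> x; apply/flattenP/idP => [[p]|xA].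
    by rewrite mem_filter => /andP[/allP pA _] /pA.
  have : x \in flatten ps by rewrite m inE xA.
  case/flattenP=> p pps xp; exists p; rewrite // mem_filter pps andbT.
  have [y [z wp]] := w p pps.
  case: (walk_side es nAB _ wp) => [t tp|pA|pB].
  - by rewrite -m; apply/flattenP; exists p.
  - exact/allP.
  - by have := pB x xp; rewrite (disjointFr dAB xA).
have sub p : p \in ps -> ~~ a p -> {subset p <= B}.
  move=> pps ap; have [y [z wp]] := w p pps.
  case: (walk_side es nAB _ wp) => [t tp|pA|//].
  - by rewrite -m; apply/flattenP; exists p.
  - by case/allP: ap.
move=> x; apply/flattenP/idP => [[p]|xB].
  by rewrite mem_filter => /andP[ap pps]; apply: sub.
have : x \in flatten ps by rewrite m inE xB orbT.
case/flattenP=> p pps xp; exists p; rewrite // mem_filter pps andbT /=.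
by apply/allP=> /(_ x xp); rewrite /= (disjointFl dAB xB).
Qed.

Lemma unmergeable_sub e ps qs :
  {subset qs <= ps} -> unmergeable e ps -> unmergeable e qs.
Proof. by move=> s um p q /s pp /s qp; apply: um. Qed.
End Cographs.

(** * Path partitions of P4-free sets *)

Section Scattering.
Variables (V : finType) (e : rel V).
Hypotheses (e_sym : symmetric e) (e_irr : irreflexive e).
Implicit Types (A B K X : {set V}) (p q : seq V) (ps qs : seq (seq V)).

(** An edge between the two starts leaves the two last vertices as ends, which is an allowed
    pairing; an edge from a last vertex to a start would leave an excluded one. *)
Lemma unmergeable_starts ps p q x y z t : unmergeable e ps ->
  p \in ps -> q \in ps -> p != q -> walk e x y p -> walk e z t q -> ~~ e x z.
Proof.
move=> um pps qps pq wp wq; apply/negP=> exz; apply: (um p q) => //.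
exists (rev p ++ q), x, y, z, t; split=> //; first by rewrite perm_cat2r perm_rev.
by apply: Or44; apply: walk_cat (walk_rev e_sym wp) wq exz.
Qed.

Lemma unmergeable_ends ps p q x y z t : unmergeable e ps ->
  p \in ps -> q \in ps -> p != q -> walk e x y p -> walk e z t q -> ~~ e y t.
Proof.
move=> um pps qps pq wp wq; apply/negP=> eyt; apply: (um p q) => //.
exists (p ++ rev q), x, y, z, t; split=> //; first by rewrite perm_cat2l perm_rev.
by apply: Or43; apply: walk_cat wp (walk_rev e_sym wq) eyt.
Qed.

Lemma walk_crossing A B x y p : {subset p <= A :|: B} -> [disjoint A & B] ->
  x \in A -> y \in B -> walk e x y p ->
  exists p1 p2 u v, [/\ p = p1 ++ p2, walk e x u p1, walk e v y p2, u \in A & v \in B].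
Proof.
move=> sp dAB; elim: p x sp => // a p IH x sp xA yB.
case: p IH sp => [|b p] IH sp.
  case/and3P=> /eqP ax /eqP/= ay _.
  by move: xA; rewrite -ax ay (disjointFl dAB).
case/and3P=> /eqP ax sy /= /andP[eab pbp]; subst a.
have sb : {subset b :: p <= A :|: B} by move=> z zp; apply: sp; rewrite inE zp orbT.
have wb : walk e b y (b :: p) by rewrite /walk eqxx sy.
have := sb b (mem_head _ _); rewrite inE => /orP[bA|bB]; last first.
  by exists [:: x], (b :: p), x, b; split; rewrite ?walk1.
have [p1 [p2 [u [v [-> w1 w2 uA vB]]]]] := IH b sb bA yB wb.
by exists (x :: p1), p2, u, v; split=> //; apply: walk_cons w1 eab.
Qed.

(* Otherwise two paths could be linked, or one inserted into the other, by edges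
   between A and B. *)
Lemma unmergeable_join_side A B ps : [disjoint A & B] ->
  {in A & B, forall x y, e x y} ->
  path_partition e (A :|: B) ps -> unmergeable e ps -> 1 < size ps ->
  (exists p x y, [/\ p \in ps, walk e x y p & x \in A]) ->
  {in ps, forall p, exists x y,
    [/\ x \in A, y \in A & walk (fun u v => e u v && ((u \in A) || (v \in A))) x y p]}.
Proof.
move=> dAB eAB [u m w] um s1 [p0 [x0 [y0 [p0ps w0 x0A]]]].
have eBA x y : x \in B -> y \in A -> e x y by move=> xB yA; rewrite e_sym eAB.
have inAB p : p \in ps -> {subset p <= A :|: B}.
  by move=> pps x xp; rewrite -m; apply/flattenP; exists p.
have other p : p \in ps -> exists2 q, q \in ps & p != q.
  move=> pps; have up : uniq ps.
    elim: (ps) u w {m um s1 p0ps inAB pps} => //= q qs IH.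
    rewrite cat_uniq => /and3P[_ /hasPn qqs uqs] w; rewrite IH // ?andbT; last first.
      by move=> r rqs; apply: w; rewrite inE rqs orbT.
    apply/negP=> qin; have [x [y /walk_head xq]] := w q (mem_head _ _).
    by have /qqs/negP[] : x \in flatten qs by apply/flattenP; exists q.
  have : 0 < size (rem p ps) by rewrite size_rem //; case: (size ps) s1 => [|[]].
  case E: (rem p ps) => [|q qs] // _.
  have : q \in rem p ps by rewrite E mem_head.
  by rewrite (mem_rem_uniq p up) inE => /andP[qp qps]; exists q; rewrite // eq_sym.
(* A path starting in [B] could be linked to the start of [p0]. *)
have startA p x y : p \in ps -> walk e x y p -> x \in A.
  move=> pps wp; have [pp|pp] := eqVneq p0 p.
    by move: wp; rewrite -pp => /(walk_inj w0)[<-].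
  have := inAB p pps x (walk_head wp); rewrite inE => /orP[//|xB].
  by have := unmergeable_starts um p0ps pps pp w0 wp; rewrite eAB.
have endA p x y : p \in ps -> walk e x y p -> y \in A.
  move=> pps wp; have := inAB p pps y (walk_last wp); rewrite inE => /orP[//|yB].
  have [q qps pq] := other p pps; have [z [t wq]] := w q qps.
  have := inAB q qps t (walk_last wq); rewrite inE => /orP[tA|tB].
    by have := unmergeable_ends um pps qps pq wp wq; rewrite eBA.
  (* Both paths now run from [A] to [B]. Each is cut at an edge leading from [A] to [B], and the
     halves of [q], exchanged, are inserted into [p]: all three new edges join [A] and [B]. *)
  have xA := startA _ _ _ pps wp; have zA := startA _ _ _ qps wq.
  have [p1 [p2 [a [b [pE w1 w2 aA bB]]]]] := walk_crossing (inAB p pps) dAB xA yB wp.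
  have [q1 [q2 [c [d [qE w3 w4 cA dB]]]]] := walk_crossing (inAB q qps) dAB zA tB wq.
  case: (um p q) => //.
  exists (p1 ++ (q2 ++ q1) ++ p2), x, y, z, t; split=> //.
    apply/permP=> k; rewrite pE qE !count_cat; clear; lia.
  apply: Or41; apply: walk_cat w1 _ (eAB a d aA dB).
  by apply: walk_cat (walk_cat w4 w3 (eBA _ _ tB zA)) w2 (eAB c b cA bB).
move=> p pps; have [x [y wp]] := w p pps; exists x, y.
have xA := startA _ _ _ pps wp; have yA := endA _ _ _ pps wp; split=> //.
(* Between two consecutive vertices of [B] another path, having both ends in [A], could be
   inserted. *)
have noBB p1 a b p2 : p = p1 ++ a :: b :: p2 -> (a \in A) || (b \in A).
  move=> pE; apply: contraT; rewrite negb_or => /andP[aA bA].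
  have aB : a \in B.
    have := inAB p pps a; rewrite pE mem_cat inE eqxx orbT inE (negPf aA).
    exact.
  have bB : b \in B.
    have := inAB p pps b; rewrite pE mem_cat !inE eqxx !orbT (negPf bA).
    exact.
  have [q qps pq] := other p pps; have [z [t wq]] := w q qps.
  have pE' : p = rcons p1 a ++ b :: p2 by rewrite pE cat_rcons.
  have wp' := wp; rewrite pE' in wp'.
  have n1 : rcons p1 a != [::] by case: (p1).
  have [c [d [w1 w2 _]]] := walk_split wp' n1 isT.
  have ca : c = a.
    by move: w1; case: (p1) => [|h r] /= /and3P[_ /eqP<- _]; rewrite ?last_rcons.
  have db : d = b by case/and3P: w2 => /eqP.
  subst c d; case: (um p q) => //.
  exists (rcons p1 a ++ q ++ b :: p2), x, y, z, t; split=> //.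
    by apply/permP=> k; rewrite pE' !count_cat; clear; lia.
  apply: Or41; apply: walk_cat w1 (walk_cat wq w2 _) _.
    exact: eAB (endA _ _ _ qps wq) bB.
  exact: eBA aB (startA _ _ _ qps wq).
elim: p x wp noBB {xA yA pps} => // a [|b p] IH x.
  by case/and3P=> /eqP-> /eqP<- _ _; rewrite walk1.
case/and3P=> /eqP ax sy; rewrite [path _ _ _]/= => /andP[eab pbp] nB; subst a.
apply: (walk_cons (y := b)); last by rewrite eab; apply: (nB [::] x b p).
apply: IH; first by rewrite /walk eqxx sy.
by move=> p1 c d p2 pE; apply: (nB (x :: p1) c d p2); rewrite pE.
Qed.

(** Every vertex of [B] is interior to its path, between two vertices of [A], and sees the ends of
    all paths. Cutting at these vertices thus keeps the paths unmergeable and adds one path each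
    time. *)
Lemma unmergeable_join_refine A B ps : [disjoint A & B] ->
  {in A & B, forall x y, e x y} ->
  path_partition e (A :|: B) ps -> unmergeable e ps -> 1 < size ps ->
  (exists p x y, [/\ p \in ps, walk e x y p & x \in A]) ->
  exists qs : seq (seq V),
    [/\ path_partition e A qs, unmergeable e qs & size qs = size ps + #|B|].
Proof.
move=> dAB eAB pp um s1 ex.
have side := unmergeable_join_side dAB eAB pp um s1 ex.
(* Walks for [r] have no two consecutive vertices in [B], so that every piece stays nonempty with
   its ends in [A]. *)
pose r u v := e u v && ((u \in A) || (v \in A)).
have re : subrel r e by move=> u v /andP[].
pose Phi qs := [/\ uniq (flatten qs), 1 < size qs, unmergeable e qs &
  {in qs, forall p, exists x y, [/\ x \in A, y \in A & walk r x y p]}].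
have eBA x y : x \in B -> y \in A -> e x y by move=> xB yA; rewrite e_sym eAB.
case: (pp) => u m w.
have step l1 p1 b p2 l2 : b \in B -> Phi (l1 ++ (p1 ++ b :: p2) :: l2) ->
    Phi (l1 ++ p1 :: p2 :: l2).
  move=> bB [uq sq umq sideq].
  have bA : b \in A = false by rewrite (disjointFl dAB).
  have [x [y [xA yA wP]]] : exists x y, [/\ x \in A, y \in A & walk r x y (p1 ++ b :: p2)].
    by apply: sideq; rewrite mem_cat mem_head orbT.
  have p1n : p1 != [::].
    by case: (p1) wP => //= /and3P[/eqP bx _ _]; rewrite -bx bA in xA.
  have [a [b' [w1 w2 /andP[_]]]] := walk_split wP p1n isT.
  have -> : b' = b by case/and3P: w2 => /eqP.
  rewrite bA orbF => aA.
  have p2n : p2 != [::].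
    apply/eqP=> p20; move: w2; rewrite p20 => /and3P[_ /eqP/= by_ _].
    by rewrite -by_ bA in yA.
  have [b'' [c [w3 w4 /andP[_]]]] := walk_split (w2 : walk r b' y ([:: b] ++ p2)) isT p2n.
  have -> : b'' = b by case/and3P: w3 => _ /eqP.
  rewrite bA /= => cA.
  have side' : {in l1 ++ p1 :: p2 :: l2, forall p,
                 exists x y, [/\ x \in A, y \in A & walk r x y p]}.
    move=> p; rewrite mem_cat !inE => /or4P[pl|/eqP->|/eqP->|pl].
    - by apply: sideq; rewrite mem_cat pl.
    - by exists x, a.
    - by exists c, y.
    - by apply: sideq; rewrite mem_cat inE pl !orbT.
  have fpe : flatten (l1 ++ (p1 ++ b :: p2) :: l2) =
    (flatten l1 ++ p1) ++ b :: (p2 ++ flatten l2) by rewrite flatten_cat /= -!catA.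
  split=> //.
  - move: uq; rewrite fpe flatten_cat /= catA !(uniq_catC (flatten l1 ++ p1)) /=.
    by case/andP.
  - by move: sq; rewrite !size_cat /=; clear; lia.
  - apply: (@unmergeable_split _ _ e_sym l1 p1 b p2 l2) => //.
      by move: sq; rewrite !size_cat /=; clear; lia.
    move=> p pin; have [|z [t [zA tA wp]]] := side' p.
      by move: pin; rewrite !(mem_cat, in_cons); case: (p == p1); case: (p == p2);
         rewrite ?orbT.
    by exists z, t; split; rewrite ?eBA //; apply: sub_walk wp.
have Phips : Phi ps by split.
have [qs [Phiqs fE sE]] := split_pieces step Phips.
case: Phiqs => uq _ umq sideq; exists qs; split=> //.
  split=> // [x|p /sideq[x [y [_ _ /(sub_walk re) wp]]]]; last by exists x, y.
  rewrite fE mem_filter /= m inE; case: (boolP (x \in A)) => xA /=.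
    by rewrite (disjointFr dAB xA).
  by case: (x \in B).
rewrite sE -size_filter; congr (_ + _).
have uB : uniq (filter (mem B) (flatten ps)) by rewrite filter_uniq.
rewrite -(card_uniqP uB); apply: eq_card => x; rewrite mem_filter /= m inE.
by case: (x \in B); rewrite ?orbT.
Qed.

(* A minimum path cover is unmergeable, so this contains Jung's min-max formula
   for path covers of P4-free graphs. *)
Lemma unmergeable_scattering K ps : P4_free e K -> path_partition e K ps ->
  unmergeable e ps ->
  exists2 X : {set V}, X \subset K & ge_comps e (#|X| + size ps) (K :\: X).
Proof.
move: {2}#|K| (leqnn #|K|) => n; elim: n K ps => [|n IH] K ps Kn PK pp um.
  have K0 : K = set0 by apply/eqP; rewrite -cards_eq0; lia.
  have := path_partition_size pp; rewrite K0 cards0 leqn0 => /eqP->.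
  by exists set0; rewrite ?sub0set // cards0 setD0; apply: ge_comps0.
have [s1|s1] := leqP (size ps) 1.
  exists set0; rewrite ?sub0set // cards0 setD0.
  have [K0|K0] := eqVneq K set0.
    have := path_partition_size pp; rewrite K0 cards0 leqn0 => /eqP->.
    exact: ge_comps0.
  exact: ge_comps_le s1 (ge_comps1 e K0).
have K1 : 1 < #|K| by apply: leq_trans s1 (path_partition_size pp).
have card2 A B : [disjoint A & B] -> A :|: B = K -> A != set0 -> B != set0 ->
    [/\ #|A| + #|B| = #|K|, 0 < #|A| & 0 < #|B|].
  move=> dAB <-; rewrite -!card_gt0; split=> //.
  by rewrite cardsU (disjoint_setI0 dAB) cards0 subn0.
(* If [K] is disconnected, each path stays on one side, and both the cuts and the component counts
   of the sides add up. *)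
case: (P4_free_splits e_sym e_irr PK K1) => [] [A [B [ABK dAB A0 B0 nAB]]].
  have [cE cA cB] := card2 A B dAB ABK A0 B0.
  rewrite -ABK in pp; have [qs [rs [pqr ppA ppB]]] := path_partition_side e_sym nAB dAB pp.
  have sA : A \subset K by rewrite -ABK subsetUl.
  have sB : B \subset K by rewrite -ABK subsetUr.
  have umA : unmergeable e qs.
    by apply: unmergeable_sub um => p pin; rewrite (perm_mem pqr) mem_cat pin.
  have umB : unmergeable e rs.
    by apply: unmergeable_sub um => p pin; rewrite (perm_mem pqr) mem_cat pin orbT.
  have An : #|A| <= n by clear - Kn cE cB; lia.
  have Bn : #|B| <= n by clear - Kn cE cA; lia.
  have [X XA gX] := IH A qs An (sub_P4_free sA PK) ppA umA.
  have [Y YB gY] := IH B rs Bn (sub_P4_free sB PK) ppB umB.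
  exists (X :|: Y); first by rewrite -ABK setUSS.
  have dXY : [disjoint X & Y] by apply: disjointWl XA (disjointWr YB dAB).
  have -> : K :\: (X :|: Y) = (A :\: X) :|: (B :\: Y).
    apply/setP=> x; rewrite -ABK !inE.
    case: (boolP (x \in A)) => [xA|xA].
      have xB : x \notin B by rewrite (disjointFr dAB xA).
      by rewrite (negPf xB) !andbF !orbF (contraNF (subsetP YB x)) ?orbF.
    by rewrite !andbF /= (contraNF (subsetP XA x)).
  have -> : #|X :|: Y| + size ps = (#|X| + size qs) + (#|Y| + size rs).
    have -> : size ps = size qs + size rs by rewrite (perm_size pqr) size_cat.
    by rewrite cardsU (disjoint_setI0 dXY) cards0 subn0; clear; lia.
  apply: ge_compsU => //.
    by apply: disjointWl (subsetDl A X) (disjointWr (subsetDl B Y) dAB).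
  by move=> x y /setDP[xA _] /setDP[yB _]; apply: nAB.
wlog [p [x [y [pps wp xA]]]] : A B ABK dAB A0 B0 nAB /
    exists p x y, [/\ p \in ps, walk e x y p & x \in A].
  move=> WL; have [u m w] := pp.
  have [p pps] : exists p, p \in ps.
    by case: (ps) s1 => // p qs _; exists p; rewrite mem_head.
  have [x [y wp]] := w p pps.
  have : x \in K by rewrite -m; apply/flattenP; exists p => //; apply: walk_head wp.
  rewrite -{1}ABK inE => /orP[xA|xB].
    by apply: (WL A B) => //; exists p, x, y.
  apply: (WL B A) => //; last by exists p, x, y.
  - by rewrite setUC.
  - by rewrite disjoint_sym.
  - by move=> a b aB bA; rewrite (co_sym e_sym); apply: nAB.
have eAB : {in A & B, forall x y, e x y}.
  move=> a b aA bB; have := nAB a b aA bB; rewrite /co negb_and !negbK => /orP[/eqP ab|//].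
  by move: bB; rewrite -ab (disjointFr dAB aA).
have [cE cA cB] := card2 A B dAB ABK A0 B0.
have ppAB : path_partition e (A :|: B) ps by rewrite ABK.
have [qs [ppA umA sE]] : exists qs : seq (seq V),
    [/\ path_partition e A qs, unmergeable e qs & size qs = size ps + #|B|].
  by apply: unmergeable_join_refine => //; exists p, x, y.
have sA : A \subset K by rewrite -ABK subsetUl.
have An : #|A| <= n by clear - Kn cE cB; lia.
have [X XA gX] := IH A qs An (sub_P4_free sA PK) ppA umA.
have dXB : [disjoint X & B] := disjointWl XA dAB.
(* Adding [B] to the cut costs exactly the number of paths gained by cutting at [B]. *)
exists (X :|: B); first by rewrite -ABK setSU.
have -> : K :\: (X :|: B) = A :\: X.
  apply/setP=> z; rewrite -ABK !inE negb_or; case: (boolP (z \in A)) => zA /=.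
    by rewrite (disjointFr dAB zA) /= andbT.
  by rewrite andbF -andbA andNb andbF.
have -> // : #|X :|: B| + size ps = #|X| + size qs.
by rewrite cardsU (disjoint_setI0 dXB) cards0 subn0 sE; clear; lia.
Qed.

End Scattering.

(** * Hamiltonian paths with given ends *)

Section HamiltonConnected.
Variables (V : finType) (e : rel V).
Hypotheses (e_sym : symmetric e) (e_irr : irreflexive e).
Implicit Types (A B D K M X : {set V}) (p q : seq V) (ps qs : seq (seq V)).

Lemma path_partition_singletons K : path_partition e K [seq [:: x] | x <- enum K].
Proof.
have -> : path_partition e K [seq [:: x] | x <- enum K] <->
  [/\ uniq (enum K), enum K =i K & pathlist e [seq [:: x] | x <- enum K]].
  by rewrite /path_partition flatten_map1 map_id.
split; [exact: enum_uniq | by move=> x; rewrite mem_enum |].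
by move=> p /mapP[x _ ->]; exists x, x; apply: walk1.
Qed.

Lemma path_partition_merge K p q s ps : path_partition e K (p :: q :: ps) ->
  perm_eq s (p ++ q) -> (exists x y, walk e x y s) -> path_partition e K (s :: ps).
Proof.
case=> u m w spq ws.
have pf : perm_eq (flatten (s :: ps)) (flatten (p :: q :: ps)).
  by rewrite /= catA perm_cat2r.
split; [by rewrite (perm_uniq pf) | by move=> x; rewrite (perm_mem pf) m |].
by move=> r; rewrite inE => /orP[/eqP->//|rps]; apply: w; rewrite !inE rps !orbT.
Qed.

(** A partition into as few paths as possible is unmergeable, since a merge would save one path. *)
Lemma path_cover K : P4_free e K -> exists ps : seq (seq V), path_partition e K ps /\
  exists2 X : {set V}, X \subset K & ge_comps e (#|X| + size ps) (K :\: X).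
Proof.
move=> PK.
pose good n :=
  `[< exists2 ps : seq (seq V), path_partition e K ps & size ps = n >].
have ex : exists n, good n.
  exists (size [seq [:: x] | x <- enum K]); apply/asboolP.
  by exists [seq [:: x] | x <- enum K] => //; apply: path_partition_singletons.
case: (ex_minnP ex) => n /asboolP[ps pp sn] min; exists ps; split=> //.
apply: unmergeable_scattering => // p q pps qps pq [s [x [y [z [t [sE wp wq ws]]]]]].
have q' : q \in rem p ps.
  by move: qps; rewrite (perm_mem (perm_to_rem pps)) inE eq_sym (negPf pq).
have pE : perm_eq ps (p :: q :: rem q (rem p ps)).
  apply: (perm_trans (perm_to_rem pps)); rewrite perm_cons.
  exact: perm_to_rem.
have := path_partition_merge (path_partition_perm pE pp) sE.
case/(_ _)/Wrap; first by case: ws; [exists x, y|exists z, t|exists x, z|exists y, t].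
move=> pp'; have := min _ (asboolT (ex_intro2 _ _ _ pp' erefl)).
by rewrite -sn (perm_size pE) /= ltnn.
Qed.

Lemma path_partition_refine K ps t : path_partition e K ps ->
  size ps <= t <= #|K| -> exists2 qs : seq (seq V), path_partition e K qs & size qs = t.
Proof.
move=> pp /andP[]; move: {2}(t - size ps) (leqnn (t - size ps)) => n.
elim: n ps pp => [|n IH] ps pp tn pt tK; first by exists ps => //; lia.
have [->|ne] := eqVneq t (size ps); first by exists ps.
have [p pps p2] : exists2 p, p \in ps & 1 < size p.
  apply/hasP; apply: contraT => /hasPn h; case: (pp) => u m _.
  have : #|K| <= size ps; last first.
    by move=> Ks; case/eqP: ne; apply/eqP; rewrite eqn_leq (leq_trans tK Ks).
  rewrite -(eq_card m) (card_uniqP u) size_flatten /shape.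
  elim: (ps) h => //= p qs IHq h; have := h p (mem_head _ _).
  have /IHq IHqs : {in qs, forall q, ~~ (1 < size q)}.
    by move=> q qqs; apply: h; rewrite inE qqs orbT.
  by rewrite -leqNgt => p1; apply: leq_add p1 IHqs.
case: p pps p2 => // a [//|b p] pps _.
have pE := perm_to_rem pps; have pp' := path_partition_perm pE pp.
have sz := perm_size pE; rewrite /= in sz.
apply: (IH ([:: a] :: (b :: p) :: rem (a :: b :: p) ps)) => //=; try lia.
case: pp' => u m w; split=> //.
move=> r; rewrite !inE => /or3P[/eqP->|/eqP->|rin].
- by exists a, a; apply: walk1.
- have [x [y]] := w _ (mem_head _ _); case/and3P=> _ sy /= /andP[_ pbp].
  by exists b, y; rewrite /walk eqxx sy.
- by apply: w; rewrite inE rin orbT.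
Qed.

(** The paths of the two lists are traversed alternately; every link joins [A] and [B]. *)
Lemma walk_interleave A B ps qs : {in A & B, forall x y, e x y} ->
  pathlist e ps -> pathlist e qs -> {subset flatten ps <= A} ->
  {subset flatten qs <= B} -> size ps = size qs -> 0 < size ps ->
  exists (s : seq V) x y,
    [/\ walk e x y s, x \in A, y \in B & perm_eq s (flatten ps ++ flatten qs)].
Proof.
move=> eAB; elim: ps qs => // p ps IH [//|q qs] wps wqs sA sB /= [sz] _.
have [x [y wp]] := wps p (mem_head _ _); have [z [t wq]] := wqs q (mem_head _ _).
have xA : x \in A by apply: sA; rewrite mem_cat (walk_head wp).
have yA : y \in A by apply: sA; rewrite mem_cat (walk_last wp).
have zB : z \in B by apply: sB; rewrite mem_cat (walk_head wq).
have tB : t \in B by apply: sB; rewrite mem_cat (walk_last wq).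
have wpq := walk_cat wp wq (eAB _ _ yA zB).
have [s0|s0] := posnP (size ps).
  exists (p ++ q), x, t; split=> //.
  by move/size0nil: s0 (sz) => -> /esym/size0nil-> /=; rewrite !cats0.
have [||||s [u [v [ws uA vB sE]]]] := IH qs _ _ _ _ sz s0.
- by move=> r rin; apply: wps; rewrite inE rin orbT.
- by move=> r rin; apply: wqs; rewrite inE rin orbT.
- by move=> r rin; apply: sA; rewrite mem_cat rin orbT.
- by move=> r rin; apply: sB; rewrite mem_cat rin orbT.
exists ((p ++ q) ++ s), x, v; split=> //.
  by apply: walk_cat wpq ws _; rewrite e_sym eAB.
by apply/permP=> k; rewrite !count_cat (permP sE) !count_cat; clear; lia.
Qed.

Lemma walk_interleave_odd A B ps qs : {in A & B, forall x y, e x y} ->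
  pathlist e ps -> pathlist e qs -> {subset flatten ps <= A} ->
  {subset flatten qs <= B} -> size qs = (size ps).+1 ->
  exists (s : seq V) x y,
    [/\ walk e x y s, x \in B, y \in B & perm_eq s (flatten ps ++ flatten qs)].
Proof.
move=> eAB; case: qs => // q qs wps wqs sA sB [sz].
have [z [t wq]] := wqs q (mem_head _ _).
have zB : z \in B by apply: sB; rewrite mem_cat (walk_head wq).
have tB : t \in B by apply: sB; rewrite mem_cat (walk_last wq).
have [s0|s0] := posnP (size ps).
  exists q, z, t; split=> //.
  by move/size0nil: s0 (sz) => -> /size0nil-> /=; rewrite cats0.
have wqs' : pathlist e qs by move=> r rin; apply: wqs; rewrite inE rin orbT.
have sB' : {subset flatten qs <= B} by move=> r rin; apply: sB; rewrite mem_cat rin orbT.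
have [s [u [v [ws uA vB sE]]]] := walk_interleave eAB wps wqs' sA sB' (esym sz) s0.
exists (q ++ s), z, v; split=> //.
  by apply: walk_cat wq ws _; rewrite e_sym eAB.
by rewrite perm_sym /= perm_catCA perm_cat2l perm_sym.
Qed.

Definition ham_linked D a b := exists s : seq V, [/\ walk e a b s, uniq s & s =i D].

Lemma ham_linked_sym D a b : ham_linked D a b -> ham_linked D b a.
Proof.
case=> s [ws us sD]; exists (rev s); split; rewrite ?rev_uniq ?walk_rev //.
by move=> x; rewrite mem_rev.
Qed.

(* Slightly weaker than 3-toughness, which would read [3 * c <= #|X|]. *)
Definition tough3 D :=
  forall X c, 1 < c -> ge_comps e c (D :\: X) -> 3 * c <= #|X| + 2.

(** The set [X] of [path_cover], enlarged by [D :\: K], leaves [#|X| + size ps] components of [D];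
    in the toughness bound three times [#|X|] on one side absorbs the [#|X|] on the other. *)
Lemma tough3_cover D K : P4_free e D -> tough3 D -> K \subset D ->
  exists2 ps : seq (seq V), path_partition e K ps &
    size ps <= 1 \/ 3 * size ps <= #|D :\: K| + 2.
Proof.
move=> PD tD KD; have [ps [pp [X XK gX]]] := path_cover (sub_P4_free KD PD).
exists ps => //; have [s1|s1] := leqP (size ps) 1; [by left | right].
have E : K :\: X = D :\: ((D :\: K) :|: X).
  apply/setP=> x; rewrite !inE; case: (boolP (x \in K)) => xK /=.
    by rewrite (subsetP KD x xK) andbT.
  by rewrite andbF; case: (x \in D); rewrite ?andbF.
have c1 : 1 < #|X| + size ps := leq_trans s1 (leq_addl _ _).
rewrite E in gX; have := tD _ _ c1 gX; have [h _] := leq_card_setU (D :\: K) X.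
by move: h; clear; lia.
Qed.

Section Join.
Variables (D M N : {set V}).
Hypotheses (PD : P4_free e D) (tD : tough3 D).
Hypotheses (MND : M :|: N = D) (dMN : [disjoint M & N]).
Hypothesis (eMN : {in M & N, forall x y, e x y}).

Let sMD : M \subset D. Proof. by rewrite -MND subsetUl. Qed.
Let sND : N \subset D. Proof. by rewrite -MND subsetUr. Qed.
Let eNM : {in N & M, forall x y, e x y}.
Proof. by move=> x y xN yM; rewrite e_sym eMN. Qed.
Let cD : #|D| = #|M| + #|N|.
Proof. by rewrite -MND cardsU (disjoint_setI0 dMN) cards0 subn0. Qed.
Let cDD K : K \subset D -> #|D :\: K| + #|K| = #|D|.
Proof. by move=> KD; rewrite cardsDS // subnK // subset_leq_card. Qed.
Let inD x : x \in D = (x \in M) || (x \in N).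
Proof. by rewrite -MND inE. Qed.

(** The sets [M :\ a] and [N :\ b] are covered by few paths, refined to the same number [t] and
    interleaved between [a] and [b]. A cover of [M :\ a] by more than one path has size at most
    [(#|N| + 3) / 3], hence at most [#|N| - 1], and symmetrically, so [t] paths fit on both
    sides. *)
Lemma ham_linked_across a b : a \in M -> b \in N -> 1 < #|M| -> 1 < #|N| ->
  ham_linked D a b.
Proof.
move=> aM bN M2 N2.
have sK1 : M :\ a \subset M by apply: subsetDl.
have sK2 : N :\ b \subset N by apply: subsetDl.
have [ps pp1 h1] := tough3_cover PD tD (subset_trans sK1 sMD).
have [qs pp2 h2] := tough3_cover PD tD (subset_trans sK2 sND).
have := cDD (subset_trans sK1 sMD); have := cDD (subset_trans sK2 sND).
have := cardsD1 a M; have := cardsD1 b N; rewrite aM bN => c1 c2 c3 c4.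
have l1 := path_partition_size pp1; have l2 := path_partition_size pp2.
pose t := maxn 1 (maxn (size ps) (size qs)).
have [|ps' [u1 m1 w1] s1] := path_partition_refine (t := t) pp1.
  by rewrite /t; lia.
have [|qs' [u2 m2 w2] s2] := path_partition_refine (t := t) pp2.
  by rewrite /t; lia.
have [||||s [x [y [ws xN yM sE]]]] := walk_interleave eNM w2 w1.
- by move=> z; rewrite m2 => /(subsetP sK2).
- by move=> z; rewrite m1 => /(subsetP sK1).
- by rewrite s1.
- by rewrite s2 /t; lia.
have sm z : z \in s = (z \in M :\ a) || (z \in N :\ b).
  by rewrite (perm_mem sE) mem_cat m1 m2 orbC.
have aN : a \in N = false by rewrite (disjointFr dMN).
have bM : b \in M = false by rewrite (disjointFl dMN).
exists (a :: s ++ [:: b]); split.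
- by apply: walk_cons (walk_cat ws (walk1 e b) (eMN yM bN)) (eMN aM xN).
- rewrite /= mem_cat sm !inE aN eqxx andbF /=.
  have -> : (a == b) = false by apply/eqP=> ab; rewrite ab bM in aM.
  rewrite cat_uniq /= !andbT orbF sm !inE eqxx bM andbF /= andbT.
  rewrite (perm_uniq sE) cat_uniq u2 u1 andbT /=; apply/hasPn=> z; rewrite m1 /= m2.
  by move=> /setD1P[_ zM]; rewrite inE (disjointFr dMN zM) andbF.
move=> z; rewrite !inE mem_cat inE sm inD !inE.
by case: eqVneq => [->|_] /=; rewrite ?aM //; case: eqVneq => [->|_]; rewrite ?bN ?orbT ?orbF.
Qed.

(** Here [N] needs one path more than [M :\ a :\ b], to begin and end the interleaving. A cover of
    the latter by more than one path has size at most [(#|N| + 4) / 3], which is below [#|N|] from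
    [#|N| = 3] on; if [#|M| = 2], it is empty. *)
Lemma ham_linked_within a b : a \in M -> b \in M -> a != b ->
  (2 < #|N|) || ((#|M| == 2) && (0 < #|N|)) -> ham_linked D a b.
Proof.
move=> aM bM ab cond.
pose K := M :\ a :\ b.
have sK : K \subset M by apply: subset_trans (subsetDl _ _) (subsetDl _ _).
have [ps pp1 h1] := tough3_cover PD tD (subset_trans sK sMD).
have [qs pp2 h2] := tough3_cover PD tD sND.
have := cDD (subset_trans sK sMD); have := cDD sND.
have := cardsD1 a M; have := cardsD1 b (M :\ a); rewrite !inE aM bM eq_sym ab -/K.
move=> /= c1 c2 c3 c4.
have l1 := path_partition_size pp1; have l2 := path_partition_size pp2.
pose t := maxn (size ps) (size qs).-1.
have [|ps' [u1 m1 w1] s1] := path_partition_refine (t := t) pp1.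
  by rewrite /t; lia.
have [|qs' [u2 m2 w2] s2] := path_partition_refine (t := t.+1) pp2.
  by rewrite /t; lia.
have [|||s [x [y [ws xN yN sE]]]] := walk_interleave_odd eMN w1 w2.
- by move=> z; rewrite m1 => /(subsetP sK).
- by move=> z; rewrite m2.
- by rewrite s1.
have sm z : z \in s = (z \in K) || (z \in N) by rewrite (perm_mem sE) mem_cat m1 m2.
have aN : a \in N = false by rewrite (disjointFr dMN).
have bN : b \in N = false by rewrite (disjointFr dMN).
exists (a :: s ++ [:: b]); split.
- by apply: walk_cons (walk_cat ws (walk1 e b) (eNM yN bM)) (eMN aM xN).
- rewrite /= mem_cat sm !inE aN (negPf ab) eqxx !andbF /=.
  rewrite cat_uniq /= !andbT orbF sm !inE eqxx bN /= andbT.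
  rewrite (perm_uniq sE) cat_uniq u2 u1 andbT /=; apply/hasPn=> z; rewrite m2 /= m1.
  by move=> zN; apply/negP=> /(subsetP sK); rewrite (disjointFl dMN zN).
move=> z; rewrite !inE mem_cat inE sm inD !inE.
case: eqVneq => [->|_] /=; rewrite ?aM //; case: eqVneq => [->|_]; rewrite ?bM ?orbT ?orbF //.
Qed.

End Join.

End HamiltonConnected.

(** * Hamilton-connectedness of tough P4-free sets *)

Section Tough3.
Variables (V : finType) (e : rel V).
Hypotheses (e_sym : symmetric e) (e_irr : irreflexive e).
Variable D : {set V}.
Hypotheses (PD : P4_free e D) (tD : tough3 e D).
Implicit Types (a b : V) (L M N : {set V}).

(** If [M] were disconnected, deleting [D :\: M] would leave two components, and toughness would
    require 6 to be at most 3 + 2. *)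
Lemma tough3_join M : M \subset D -> 1 < #|M| -> #|D :\: M| <= 3 ->
  exists L N, [/\ L :|: N = M, [disjoint L & N], L != set0, N != set0 &
                  {in L & N, forall x y, e x y}].
Proof.
move=> sM M1 DM.
case: (P4_free_splits e_sym e_irr (sub_P4_free sM PD) M1) => [] [L [N [LN d L0 N0 h]]].
  have := ge_compsU e_sym d h (ge_comps1 e L0) (ge_comps1 e N0).
  have -> : L :|: N = D :\: (D :\: M) by rewrite LN setDDr setDv set0U; apply/esym/setIidPr.
  by move=> g; have := @tD (D :\: M) 2 isT g; move: DM; clear; lia.
exists L, N; split=> // x y xL yN; have := h x y xL yN.
rewrite /co negb_and !negbK => /orP[/eqP xy|//].
by move: yN; rewrite -xy (disjointFr d xL).
Qed.

(** The set [D :\ a] is a join of [L], containing [b], and [N]. If [L] has another vertex, [a] is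
    moved to the side of [N] and the two sides are linked across; if [L] is the singleton of [b],
    the exceptional case of [ham_linked_within] applies to the pair [a], [b]. *)
Lemma ham_linked_universal a b : a \in D -> b \in D -> a != b ->
  {in D :\ a, forall x, e a x} -> ham_linked e D a b.
Proof.
move=> aD bD ab ea; have sM : D :\ a \subset D by apply: subsetDl.
have bM : b \in D :\ a by rewrite !inE eq_sym ab.
have cM := cardsD1 a D; rewrite aD in cM.
have [M1|M1] := ltnP 1 #|D :\ a|; last first.
  have ME : D :\ a = [set b].
    by apply/esym/eqP; rewrite eqEcard sub1set bM cards1.
  exists [:: a; b]; split.
  - by apply: (walk_cons (walk1 e b)); apply: ea.
  - by rewrite /= inE ab.
  - by move=> x; rewrite -(setD1K aD) ME !inE.
have [|L [N [LN d L0 N0 eLN]]] := tough3_join sM M1.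
  have -> : D :\: (D :\ a) = [set a].
    by rewrite setDDr setDv set0U; apply/setIidPr; rewrite sub1set.
  by rewrite cards1.
wlog bL : L N LN d L0 N0 eLN / b \in L.
  move=> WL; have := bM; rewrite -LN inE => /orP[bL|bN]; first exact: (WL L N).
  apply: (WL N L) => //; first by rewrite setUC.
    by rewrite disjoint_sym.
  by move=> x y xN yL; rewrite e_sym eLN.
have eaL x : x \in L -> e a x by move=> xL; apply: ea; rewrite -LN inE xL.
have eaN x : x \in N -> e a x by move=> xN; apply: ea; rewrite -LN inE xN orbT.
have naLN : a \notin L :|: N by rewrite LN !inE eqxx.
move: naLN; rewrite inE negb_or => /andP[aL aN].
have [L1|L1] := ltnP 1 #|L|.
  apply: (@ham_linked_across _ _ e_sym e_irr D (a |: N) L) => //.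
  - by rewrite -setUA (setUC N) LN setD1K.
  - apply/pred0P=> x /=; rewrite !inE; case: eqVneq => [->|_] /=.
      by rewrite (negPf aL).
    by apply/negP=> /andP[xN xL]; rewrite (disjointFr d xL) in xN.
  - by move=> x y; rewrite !inE => /orP[/eqP->|xN] yL; [apply: eaL | rewrite e_sym eLN].
  - by rewrite !inE eqxx.
  - by rewrite cardsU1 aN; move: N0; rewrite -card_gt0; case: #|N|.
have LE : L = [set b] by apply/esym/eqP; rewrite eqEcard sub1set bL cards1.
have bN : b \notin N by rewrite (disjointFr d bL).
apply: (@ham_linked_within _ _ e_sym e_irr D [set a; b] N) => //.
- by rewrite -setUA -LE LN setD1K.
- rewrite disjoints_subset; apply/subsetP=> x; rewrite !inE => /orP[]/eqP-> //.
- by move=> x y; rewrite !inE => /orP[/eqP->|/eqP->] yN; [apply: eaN | apply: eLN].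
- by rewrite !inE eqxx.
- by rewrite !inE eqxx orbT.
- by rewrite cards2 ab card_gt0 N0 orbT.
Qed.

Lemma ham_linked_sides M N a b : M :|: N = D -> [disjoint M & N] ->
  {in M & N, forall x y, e x y} -> a \in M -> b \in N -> ham_linked e D a b.
Proof.
move=> MN d eMN aM bN.
have aD : a \in D by rewrite -MN inE aM.
have bD : b \in D by rewrite -MN inE bN orbT.
have ab : a != b by apply/eqP=> ab; rewrite ab (disjointFl d) in aM.
have [M1|M1] := ltnP 1 #|M|; last first.
  have ME : M = [set a] by apply/esym/eqP; rewrite eqEcard sub1set aM cards1.
  apply: ham_linked_universal => // x; rewrite -MN ME !inE => /andP[/negPf-> /= xN].
  exact: eMN.
have [N1|N1] := ltnP 1 #|N|; last first.
  have NE : N = [set b] by apply/esym/eqP; rewrite eqEcard sub1set bN cards1.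
  apply/ham_linked_sym/ham_linked_universal => //; first by rewrite eq_sym.
  move=> x; rewrite -MN NE !inE => /andP[/negPf->]; rewrite orbF => xM.
  by rewrite e_sym eMN.
exact: (@ham_linked_across _ _ e_sym e_irr D M N).
Qed.

(** Induction on a set [M] containing [a] and [b] and complete to the rest of [D], starting from
    [D]. If the rest has at least three vertices, [ham_linked_within] concludes. Otherwise [M] is
    itself a join: either [a] and [b] lie on different sides, or [M] shrinks to their common
    side. *)
Lemma ham_connected a b : a \in D -> b \in D -> a != b -> ham_linked e D a b.
Proof.
move=> aD bD ab.
suff H n M : #|M| <= n -> M \subset D -> {in M & D :\: M, forall x y, e x y} ->
    a \in M -> b \in M -> ham_linked e D a b.
  by apply: (H #|D| D) => // x y _; rewrite setDv inE.
elim: n M => [|n IH] M Mn sM eM aM bM.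
  by move: Mn; rewrite leqn0 cards_eq0 => /eqP M0; rewrite M0 inE in aM.
have MDU : M :|: (D :\: M) = D by rewrite -{1}(setIidPr sM) setID.
have dM : [disjoint M & D :\: M] by rewrite disjoint_sym disjoints_subset setDE subsetIr.
have M2 : 1 < #|M|.
  have : [set a; b] \subset M by rewrite subUset !sub1set aM.
  by move/subset_leq_card; rewrite cards2 ab.
have [DM|DM] := ltnP 2 #|D :\: M|.
  by apply: (@ham_linked_within _ _ e_sym e_irr D M (D :\: M)) => //; rewrite DM.
have [|L [N [LN d L0 N0 eLN]]] := tough3_join sM M2; first exact: leq_trans DM _.
have rest A B : A :|: B = M -> [disjoint A & B] -> D :\: A = B :|: (D :\: M).
  move=> AB dAB; apply/setP=> x; rewrite -AB !inE.
  case: (boolP (x \in A)) => xA /=; first by rewrite (disjointFr dAB xA).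
  case: (boolP (x \in B)) => xB //=.
  by apply: (subsetP sM); rewrite -AB inE xB orbT.
have inside A B : A :|: B = M -> [disjoint A & B] -> B != set0 ->
    {in A & B, forall x y, e x y} -> a \in A -> b \in A -> ham_linked e D a b.
  move=> AB dAB B0 eAB aA bA; have sA : A \subset M by rewrite -AB subsetUl.
  apply: (IH A) => //; last first.
  - move=> x y xA; rewrite (rest A B) // inE => /orP[yB|yD]; first exact: eAB.
    by apply: eM => //; apply: (subsetP sA).
  - exact: subset_trans sA sM.
  have : #|A| < #|M|.
    by rewrite -AB cardsU (disjoint_setI0 dAB) cards0 subn0 -addn1 leq_add2l card_gt0.
  by move=> AM; rewrite -ltnS; apply: leq_trans AM Mn.
have across A B : A :|: B = M -> [disjoint A & B] ->
    {in A & B, forall x y, e x y} -> a \in A -> b \in B -> ham_linked e D a b.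
  move=> AB dAB eAB aA bB; have sA : A \subset M by rewrite -AB subsetUl.
  apply: (@ham_linked_sides A (D :\: A)) => //.
  - by rewrite -{1}(setIidPr (subset_trans sA sM)) setID.
  - by rewrite disjoint_sym disjoints_subset setDE subsetIr.
  - move=> x y xA; rewrite (rest A B) // inE => /orP[yB|yD]; first exact: eAB.
    by apply: eM => //; apply: (subsetP sA).
  - by rewrite (rest A B) // inE bB.
have NL : N :|: L = M by rewrite setUC.
have d' : [disjoint N & L] by rewrite disjoint_sym.
have eNL : {in N & L, forall x y, e x y} by move=> x y xN yL; rewrite e_sym eLN.
have := aM; have := bM; rewrite -{1 2}LN !inE.
case/orP=> [bL|bN] /orP[aL|aN].
- exact: (inside L N).
- exact: (across N L).
- exact: (across L N).
- exact: (inside N L).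
Qed.

End Tough3.

(** * A cycle through all components of an optimal cut *)

Section Covering.
Variables (V : finType) (e : rel V).
Hypotheses (e_sym : symmetric e) (e_irr : irreflexive e).
Implicit Types (s t x y a b : V) (S T X U : {set V}) (p q : seq V).

Lemma ge_comps_card c X : ge_comps e c X -> c <= #|X|.
Proof.
case=> f [_ fX]; have -> : c = size (iota 0 c) by rewrite size_iota.
rewrite -(size_image f X); apply: uniq_leq_size; first exact: iota_uniq.
move=> i; rewrite mem_iota => /fX[x xX <-].
by apply/mapP; exists x; rewrite ?mem_enum.
Qed.

(* Without the tie-break on the number of components, equality could hold in the
   bound 3 * (c - 1) < #|X| for components of the complement of S. *)
Definition optimal_cut S k := [/\ 1 < k, ge_comps e k (~: S) &
  forall X c, 1 < c -> ge_comps e c (~: X) ->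
    3 * c + #|S| < 3 * k + #|X| \/ (3 * c + #|S| = 3 * k + #|X| /\ c <= k)].

Lemma exists_optimal_cut x y : x != y -> ~~ e x y -> exists S k, optimal_cut S k.
Proof.
move=> xy exy; set n := #|V|.
(* The lexicographic order as one number in base [n.+1], since [c <= n]; adding [n] keeps the
   subtraction from truncating. *)
pose weight S c := (3 * c + n - #|S|) * n.+1 + c.
pose good m := `[< exists S c, [/\ 1 < c, ge_comps e c (~: S) & weight S c = m] >].
have ln S : #|S| <= n by apply: max_card.
have ex : exists m, good m.
  exists (weight (~: ([set x] :|: [set y])) 2); apply/asboolP.
  exists (~: ([set x] :|: [set y])), 2; split=> //; rewrite setCK.
  apply: (@ge_compsU _ _ 1 1) => //; try apply: ge_comps1.
  - by rewrite disjoints1 inE.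
  - by move=> u v; rewrite !inE => /eqP-> /eqP->.
  - by apply/set0Pn; exists x; rewrite inE.
  - by apply/set0Pn; exists y; rewrite inE.
have bd m : good m -> m <= 4 * n * n.+1 + n.
  case/asboolP=> S [c [_ /ge_comps_card cn <-]].
  have {}cn : c <= n := leq_trans cn (ln _).
  by apply: leq_add => //; rewrite leq_mul2r /=; lia.
case: (ex_maxnP ex bd) => m /asboolP[S [k [k1 gk wm]]] max; exists S, k; split=> //.
move=> X c c1 gc; have := max _ (asboolT (ex_intro _ X (ex_intro _ c (And3 c1 gc erefl)))).
have cn := leq_trans (ge_comps_card gc) (ln _).
have kn := leq_trans (ge_comps_card gk) (ln _).
have := ln S; have := ln X; rewrite -wm /weight.
set p := 3 * c + n - #|X|; set r := 3 * k + n - #|S| => lX lS le.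
have [pr|rp|pr] := ltngtP p r.
- by left; rewrite /p /r in pr; lia.
- have : r.+1 * n.+1 <= p * n.+1 by rewrite leq_mul2r rp.
  by rewrite mulSn; lia.
- right; rewrite pr leq_add2l in le; split=> //.
  by rewrite /p /r in pr; lia.
Qed.

Lemma walk_path_last s a b q : walk e a b q -> e s a -> path e s q /\ last s q = b.
Proof. by case: q => // c q /and3P[/eqP-> /eqP<- /= ->] ->. Qed.

Variables (S : {set V}) (k : nat).
Hypothesis tough7 : forall X c, 1 < c -> ge_comps e c (~: X) -> 7 * c <= #|X|.
Hypothesis P4P1_free :
  forall h X, {in X, forall x, (x != h) && ~~ e h x} -> P4_free e X.
Hypothesis optS : optimal_cut S k.

Variable f : V -> nat.
Hypothesis f_edge : {in ~: S &, forall x y, e x y -> f x = f y}.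
Hypothesis f_onto : forall i, i < k -> exists2 x, x \in ~: S & f x = i.
Hypothesis f_lt : forall x, f x < k.

Let part (i : nat) := [set x in ~: S | f x == i].

Let k1 : 1 < k. Proof. by case: optS. Qed.

Let S7 : 7 * k <= #|S|. Proof. by case: optS => _ gk _; apply: tough7. Qed.

Lemma other_part i : exists2 x, x \in ~: S & f x != i.
Proof.
have [->|i0] := eqVneq i 0; last first.
  by have [|x xS fx] := @f_onto 0; [exact: ltnW | exists x; rewrite // fx eq_sym].
by have [x xS fx] := f_onto k1; exists x; rewrite // fx.
Qed.

Lemma part_anticomplete i x y : x \in part i -> y \in ~: S -> y \notin part i ->
  ~~ e x y.
Proof.
rewrite [x \in _]inE => /andP[xS /eqP fx] yS; rewrite inE yS /= => fy.
by apply: contra fy => exy; rewrite -fx (f_edge xS yS exy).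
Qed.

Lemma part_P4_free i : P4_free e (part i).
Proof.
have [h hS fh] := other_part i; apply: (@P4P1_free h) => x xi.
have hi : h \notin part i by rewrite inE hS.
rewrite e_sym (part_anticomplete xi) // andbT.
by apply: contraNneq hi => <-.
Qed.

Lemma ge_comps_rest i : i < k -> ge_comps e k.-1 (~: S :\: part i).
Proof.
move=> ik; exists (fun x => if f x < i then f x else (f x).-1); split.
  move=> x y /setDP[xS _] /setDP[yS _] exy; by rewrite (f_edge xS yS exy).
move=> j jk; have jk' : (if j < i then j else j.+1) < k by case: ifP; lia.
have [x xS fx] := f_onto jk'; exists x.
  by rewrite in_setD xS andbT inE xS fx /=; case: ltnP => //; lia.
by rewrite fx; case: (ltnP j i) => ji; [rewrite ji | case: ltnP => //; lia].
Qed.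

(** Adding [Y] to [S] leaves [k.-1 + c] components, more than [k], so the tie-break makes the
    optimality inequality strict: [3 * c - 3 < #|Y|]. *)
Lemma part_tough3 i : i < k -> tough3 e (part i).
Proof.
move=> ik X c c1 gc; have [_ _ max] := optS.
pose Y := X :&: part i.
have YX : #|Y| <= #|X| by apply/subset_leq_card/subsetIl.
have SY : #|S :|: Y| <= #|S| + #|Y| by case: (leq_card_setU S Y).
have E : ~: (S :|: Y) = (~: S :\: part i) :|: (part i :\: X).
  apply/setP=> x; rewrite !inE; by case: (x \in S); case: (f x == i); rewrite ?orbF ?andbT ?andbF.
have d : [disjoint ~: S :\: part i & part i :\: X].
  rewrite disjoints_subset; apply/subsetP=> z /setDP[_ zi].
  by rewrite !in_setC in_setD (negPf zi) andbF.
have n : anticomplete e (~: S :\: part i) (part i :\: X).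
  by move=> x y /setDP[xS xi] /setDP[yi _]; rewrite e_sym (part_anticomplete yi).
have := ge_compsU e_sym d n (ge_comps_rest ik) gc; rewrite -E => /max.
move=> /(_ _); have lt1 : 1 < k.-1 + c by have := k1; lia.
by case/(_ lt1) => [|[]]; have := k1; lia.
Qed.

(* By optimality a large set of vertices of S cannot be attached to a part
   through at most one vertex: otherwise that vertex could replace them. *)
Lemma few_attached i X0 T : i < k -> X0 \proper part i -> #|X0| <= 1 -> T \subset S ->
  {in T & part i, forall s y, e s y -> y \in X0} -> #|T| + 5 <= 3 * k.
Proof.
move=> ik X0i X01 TS eT; have [_ _ max] := optS.
pose S' := (S :\: T) :|: X0.
have sub0 := proper_sub X0i.
have cS' : #|S'| + #|T| <= #|S| + 1.
  have [h _] := leq_card_setU (S :\: T) X0.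
  have := cardsDS TS; have := subset_leq_card TS; rewrite -/S' in h; lia.
have E : ~: S' = (part i :\: X0) :|: (~: S' :\: part i).
  apply/setP=> x; rewrite !inE negb_or negb_and negbK.
  case: (boolP (x \in X0)) => xX /=.
    by rewrite !andbF.
  by case: (x \in S); case: (f x == i); rewrite ?orbT ?orbF ?andbT ?andbF.
have d : [disjoint part i :\: X0 & ~: S' :\: part i].
  rewrite disjoints_subset; apply/subsetP=> z /setDP[zi _].
  by rewrite in_setC in_setD zi.
have n : anticomplete e (part i :\: X0) (~: S' :\: part i).
  move=> x y /setDP[xi xX] /setDP[yS' yi].
  have [yS|yS] := boolP (y \in S); last by apply: part_anticomplete xi _ yi; rewrite inE.
  have yT : y \in T by move: yS'; rewrite !inE yS andbT negb_or negbK => /andP[].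
  by rewrite e_sym; apply: contra xX; apply: eT.
have n0 : part i :\: X0 != set0.
  by case/properP: X0i => _ [x xi xX]; apply/set0Pn; exists x; rewrite inE xX.
have n1 : ~: S' :\: part i != set0.
  have [x xS fx] := other_part i; apply/set0Pn; exists x.
  have xi : x \notin part i by rewrite inE negb_and fx orbT.
  rewrite inE xi !inE; rewrite inE in xS; rewrite (negPf xS) andbF /=.
  by apply: contra xi; apply: (subsetP sub0).
(* Two components are left, so optimality gives [6 + #|S| <= 3 * k + #|S'|], and [#|S'|] is at most
   [#|S| + 1 - #|T|]. *)
have := ge_compsU e_sym d n (ge_comps1 e n0) (ge_comps1 e n1); rewrite -E.
by move/(max S' 2 isT) => [|[]]; lia.
Qed.

(** * Chaining the parts through vertices of S *)

Definition touches s i := [exists y in part i, e s y].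

Definition linked s i t := exists q a b,
  [/\ walk e a b q, uniq q, q =i part i, e s a & e b t].

Lemma linked_sym s i t : linked s i t -> linked t i s.
Proof.
case=> q [a [b [wq uq qi sa bt]]]; exists (rev q), b, a.
by split; rewrite ?rev_uniq ?walk_rev 1?e_sym // => x; rewrite mem_rev.
Qed.

Lemma few_untouched i : i < k -> #|[set s in S | ~~ touches s i]| + 5 <= 3 * k.
Proof.
move=> ik; apply: (@few_attached i set0) => //.
- rewrite proper0; have [x xS fx] := f_onto ik.
  by apply/set0Pn; exists x; rewrite inE xS fx eqxx.
- by rewrite cards0.
- by apply/subsetP=> s; rewrite inE => /andP[].
- move=> s y; rewrite inE => /andP[_ /exists_inP ns] yi sy.
  by case: ns; exists y.
Qed.

(** Entering at a neighbour [a] of [s], the part can be left from any other of its vertices by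
    [ham_connected]. The unlinked vertices thus attach to the part at most through [a]. *)
Lemma few_unlinked s i : i < k -> touches s i ->
  #|[set t in S | `[< ~ linked s i t >] ]| + 5 <= 3 * k.
Proof.
move=> ik /exists_inP[a ai sa].
set T := [set t in S | _].
have TS : T \subset S by apply/subsetP=> t; rewrite inE => /andP[].
(* In a part with the single vertex [a], this vertex is both entrance and exit, so unlinked vertices
   have no neighbour at all in the part. *)
have [E|nE] := eqVneq (part i) [set a].
  apply: (@few_attached i set0) => //; rewrite ?cards0 // ?proper0.
    by apply/set0Pn; exists a.
  move=> t y; rewrite [t \in _]inE E => /andP[_ /asboolP nl] /set1P-> ta; case: nl.
  exists [:: a], a, a; split; rewrite ?walk1 // 1?e_sym //.
  by move=> x; rewrite E !inE.
apply: (@few_attached i [set a]) => //; rewrite ?cards1 //.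
  by rewrite properEneq eq_sym nE sub1set.
move=> t y; rewrite [t \in _]inE => /andP[_ /asboolP nl] yi ty.
rewrite inE; apply: contraT => ya; case: nl.
have ay : a != y by rewrite eq_sym.
have [q [wq uq qi]] := ham_connected e_sym e_irr (@part_P4_free i) (part_tough3 ik) ai yi ay.
by exists q, a, y; split; rewrite // e_sym.
Qed.

(** Here [m] counts the parts after [i]: only the last one must be left towards the prescribed
    vertex [t]. *)
Definition attached t m s i : Prop := if m is 0 then linked s i t else touches s i.

(** Greedy choice of the connecting vertices, [U] being the set of those already used. The next one,
    [u], must be linked to [s] through part [i] and be able to enter part [i.+1]. *)
Lemma cover_parts t m i s U : i + m.+1 = k -> s \in U -> t \in U -> U \subset S ->
  #|U| <= i.+1 -> touches t k.-1 -> attached t m s i ->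
  exists q, [/\ path e s q, e (last s q) t, uniq q, {in U, forall x, x \notin q} &
                {in ~: S, forall x, (x \in q) = (i <= f x)}].
Proof.
elim: m i s U => [|m IH] i s U iE sU tU US cU tk.
  case=> q [a [b [wq uq qi sa bt]]]; have [pq lq] := walk_path_last wq sa.
  exists q; split=> //; first by rewrite lq.
    by move=> x /(subsetP US) xS; rewrite qi !inE xS.
  move=> x; rewrite inE => xS; rewrite qi !inE xS /= eqn_leq.
  by have := f_lt x; rewrite -iE addn1 ltnS => ->.
move=> ts; have ik : i < k by lia.
pose bad1 := [set u in S | `[< ~ linked s i u >] ].
(* If part [i.+1] is the last, [u] must be linked through it to [t]; by symmetry the exceptions are
   counted from [t], which touches this part. *)
pose bad2 := if m is 0 then [set u in S | `[< ~ linked t i.+1 u >] ]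
             else [set u in S | ~~ touches u i.+1].
have c1 : #|bad1| + 5 <= 3 * k := few_unlinked ik ts.
have c2 : #|bad2| + 5 <= 3 * k.
  rewrite /bad2; case: (m) iE => [|m'] iE; last by apply: few_untouched; lia.
  have ki : k.-1 = i.+1 by lia.
  by apply: few_unlinked; rewrite -ki //; lia.
(* At most [2 * (3 * k - 5) + (k - 1)] vertices are excluded, fewer than the [7 * k] available. *)
have [u uS] : exists2 u, u \in S & u \notin bad1 :|: bad2 :|: U.
  apply/subsetPn; apply/negP=> /subset_leq_card.
  have [h1 _] := leq_card_setU (bad1 :|: bad2) U.
  have [h2 _] := leq_card_setU bad1 bad2.
  by have := S7; lia.
rewrite !in_setU !negb_or => /andP[/andP[ub1 ub] uU].
have [q [a [b [wq uq qi sa bu]]]] : linked s i u.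
  by move: ub1; rewrite inE uS andTb => /asboolPn/contrapT.
have iE' : i.+1 + m.+1 = k by rewrite addSnnS.
have uu : u \in u |: U by rewrite !inE eqxx.
have tu : t \in u |: U by rewrite !inE tU orbT.
have US' : u |: U \subset S by rewrite subUset sub1set uS.
have cU' : #|u |: U| <= i.+2 by rewrite cardsU1 uU.
have ready : attached t m u i.+1.
  move: ub; rewrite /bad2 /attached; case: (m) => [|m']; rewrite inE uS andTb.
    by move/asboolPn/contrapT; apply: linked_sym.
  by rewrite negbK.
have [q' [pq' lq' uq' Uq' q'S]] := IH i.+1 u (u |: U) iE' uu tu US' cU' tk ready.
have [pq lq] := walk_path_last wq sa.
have uq'n : u \notin q' by apply: Uq'; rewrite !inE eqxx.
have qq' : ~~ has (mem q) q'.
  apply/hasPn=> x xq' /=; rewrite qi !inE; apply/negP=> /andP[xS /eqP fx].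
  by move: xq'; rewrite q'S ?inE // fx ltnn.
exists (q ++ u :: q'); split.
- by rewrite cat_path pq /= lq bu.
- by rewrite last_cat.
- rewrite cat_uniq uq /= uq'n uq' qi [u \in part i]inE in_setC uS /= andbT.
  exact: qq'.
- move=> x xU; rewrite mem_cat inE qi !inE (subsetP US x xU) /= negb_or.
  rewrite Uq' ?inE ?xU ?orbT // andbT.
  by apply: contraNneq uU => <-.
- move=> x xS; rewrite mem_cat inE qi q'S // [x \in part i]inE xS /=.
  have -> : (x == u) = false.
    by apply/eqP=> xu; rewrite xu inE uS in xS.
  by rewrite orFb eq_sym -leq_eqVlt.
Qed.

Lemma cycle_through_parts : exists c, ucycle e c /\ {subset ~: S <= c}.
Proof.
have k0 : 0 < k := ltnW k1.
pose bad i := [set u in S | ~~ touches u i].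
(* The cycle starts and ends at [t], which must therefore touch the first and the last part. *)
have [t tS] : exists2 t, t \in S & t \notin bad 0 :|: bad k.-1.
  apply/subsetPn; apply/negP=> /subset_leq_card.
  have [h _] := leq_card_setU (bad 0) (bad k.-1).
  have := few_untouched k0; have := @few_untouched k.-1; rewrite ltn_predL => /(_ k0).
  by rewrite -/(bad _) -/(bad _); have := S7; lia.
rewrite !inE tS /= negb_or !negbK => /andP[t0 tk].
have kE : 0 + k.-1.+1 = k by rewrite prednK.
have tt : t \in [set t] by rewrite inE.
have tS' : [set t] \subset S by rewrite sub1set.
have ct : #|[set t]| <= 1 by rewrite cards1.
(* As [1 < k], part 0 is not the last one, and touching it is enough. *)
have ready : attached t k.-1 t 0.
  by rewrite /attached; case: (k) k1 => [|[|]].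
have [q [pq lq uq Uq qS]] := cover_parts kE tt tt tS' ct tk ready.
exists (t :: q); split; last by move=> x xS; rewrite inE qS // orbT.
by rewrite /ucycle /= uq Uq ?inE // rcons_path pq lq.
Qed.

End Covering.

(** * The longest cycle *)

Section CyclePieces.
Variables (V : finType) (e : rel V).
Hypotheses (e_sym : symmetric e).
Variables (c : seq V) (W : {set V}).
Implicit Types (x y a b : V) (s p q A B : seq V).

Lemma walk_cycle x y s : walk e x y s -> e y x -> cycle e s.
Proof.
by case: s => // a s /and3P[/eqP-> /eqP sy ps] yx; rewrite /= rcons_path ps sy.
Qed.

Lemma cycle_walk s : cycle e s -> s != [::] -> exists x y, walk e x y s /\ e y x.
Proof.
case: s => // a s /=; rewrite rcons_path => /andP[ps la] _.
by exists a, (last a s); rewrite /walk !eqxx ps.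
Qed.

Lemma walk_closed_size x s : walk e x x s -> uniq s -> size s = 1.
Proof.
case: s => // a [//|b s] /and3P[/eqP-> /eqP sx _] /=.
by rewrite -{1}sx /= mem_last.
Qed.

Definition in_ends s := if s is a :: q then (a \in W) && (last a q \in W) else false.

Lemma in_endsP x y s : in_ends s -> walk e x y s -> x \in W /\ y \in W.
Proof. by case: s => // a s /andP[aW lW] /and3P[/eqP<- /eqP<- _]. Qed.

Lemma in_ends_cons b s q : b \in W -> in_ends q -> in_ends (b :: s ++ q).
Proof. by case: q => // a q bW /andP[aW lW]; rewrite /= bW last_cat. Qed.

Lemma in_ends_rcons b s q : b \in W -> in_ends q -> in_ends (q ++ s ++ [:: b]).
Proof. by case: q => // a q bW /andP[aW lW]; rewrite /= aW !last_cat. Qed.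

(* B is the rest of the cycle c, seen from the end of p. *)
Definition piece p := exists B,
  [/\ perm_eq (p ++ B) c, cycle e (p ++ B) & in_ends B].

(** The lists [A] and [B] are the two arcs of [c] that separate [p] from [q]. *)
Definition piece2 p q := exists A B,
  [/\ perm_eq (p ++ A ++ q ++ B) c, cycle e (p ++ A ++ q ++ B), in_ends A & in_ends B].

Lemma cycle_cat s q : cycle e (s ++ q) -> cycle e (q ++ s).
Proof. by rewrite -[q ++ s]rot_size_cat rot_cycle. Qed.

Lemma piece2_sym p q : piece2 p q -> piece2 q p.
Proof.
case=> A [B [pE cE Aw Bw]]; exists B, A; split=> //.
  by apply: perm_trans pE; rewrite catA perm_catC -catA.
by rewrite catA; apply: cycle_cat; rewrite -catA.
Qed.

Lemma piece_split p1 b p2 : b \in W -> piece (p1 ++ b :: p2) ->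
  [/\ piece p1, piece p2 & piece2 p1 p2].
Proof.
move=> bW [B [pE cE Bw]]; rewrite -catA /= in pE cE; split.
- by exists (b :: p2 ++ B); split=> //; apply: in_ends_cons.
- exists (B ++ p1 ++ [:: b]).
  have E : p1 ++ b :: p2 ++ B = (p1 ++ [:: b]) ++ (p2 ++ B) by rewrite -catA.
  split; last exact: in_ends_rcons.
    by rewrite catA perm_catC -E.
  by rewrite catA; apply: cycle_cat; rewrite -E.
- by exists [:: b], B; split; rewrite //= bW.
Qed.

Lemma piece2_split p1 b p2 q : b \in W -> piece2 (p1 ++ b :: p2) q ->
  piece2 p1 q /\ piece2 p2 q.
Proof.
move=> bW [A [B [pE cE Aw Bw]]]; rewrite -catA /= in pE cE; split.
  exists (b :: p2 ++ A), B; rewrite /= -!catA; split=> //.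
  exact: in_ends_cons.
exists A, (B ++ p1 ++ [:: b]).
have E : p1 ++ b :: p2 ++ A ++ q ++ B = (p1 ++ [:: b]) ++ (p2 ++ A ++ q ++ B).
  by rewrite -catA.
have E' : p2 ++ A ++ q ++ B ++ p1 ++ [:: b] = (p2 ++ A ++ q ++ B) ++ (p1 ++ [:: b]).
  by rewrite -!catA.
split=> //; last exact: in_ends_rcons.
  by rewrite E' perm_catC -E.
by rewrite E'; apply: cycle_cat; rewrite -E.
Qed.

Hypotheses (c_cycle : ucycle e c) (c_size : 1 < size c).
(* Such a path could be closed through the component outside c attached to W. *)
Hypothesis no_path : forall s x y, perm_eq s c -> walk e x y s ->
  x \in W -> y \in W -> x != y -> False.

Let c_uniq : uniq c. Proof. by case/andP: c_cycle. Qed.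

(** If [p] were empty, [B] would be all of [c], opened into a path with both ends in [W]. *)
Lemma piece_neq0 p : piece p -> p != [::].
Proof.
case=> B [pE cE Bw]; apply/eqP=> p0; rewrite p0 /= in pE cE.
have B0 : B != [::] by case: (B) Bw.
have [x [y [wB _]]] := cycle_walk cE B0; have [xW yW] := in_endsP Bw wB.
apply: (no_path pE wB xW yW); apply/eqP=> xy; move: wB; rewrite xy => /walk_closed_size.
by rewrite (perm_uniq pE) c_uniq (perm_size pE) => /(_ isT) s1; have := c_size; rewrite s1.
Qed.

(** For each of the four pairings the merged path fits between the arcs, as B s A, A s B, B s (rev
    A) or (rev A) s B, and the result spans [c] with both ends in [W]. *)
Lemma piece2_unmergeable p q : p != [::] -> q != [::] -> piece2 p q ->
  ~ mergeable e p q.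
Proof.
move=> p0 q0 [A [B [pE cE Aw Bw]]] [s [x [y [z [t [sE wp wq ws]]]]]].
have A0 : A != [::] by case: (A) Aw.
have B0 : B != [::] by case: (B) Bw.
have pAqB0 : p ++ A ++ q ++ B != [::] by case: (p) p0.
have [x' [b' [w eb]]] := cycle_walk cE pAqB0.
have nA r : A ++ r != [::] by case: (A) A0.
have nq r : q ++ r != [::] by case: (q) q0.
have [y' [a [wp' wA1 eya]]] := walk_split w p0 (nA _).
have [a' [z' [wA wq1 eaz]]] := walk_split wA1 A0 (nq _).
have [t' [b [wq' wB etb]]] := walk_split wq1 q0 B0.
have [? ?] := walk_inj wp wp'; have [? ?] := walk_inj wq wq'; subst x' y' z' t'.
have [aW a'W] := in_endsP Aw wA; have [bW b'W] := in_endsP Bw wB.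
have neq u v s1 s3 : perm_eq (s1 ++ s ++ s3) c -> u \in s1 -> v \in s3 -> u != v.
  move=> h us vs; have : uniq (s1 ++ s ++ s3) by rewrite (perm_uniq h) c_uniq.
  rewrite cat_uniq => /and3P[_ /hasPn nh _]; apply: contraTneq us => ->.
  by apply: nh; rewrite mem_cat vs orbT.
have pBA s1 s3 : perm_eq s1 B -> perm_eq s3 A -> perm_eq (s1 ++ s ++ s3) c.
  move=> h1 h3; apply: perm_trans pE; apply/permP=> k.
  by rewrite !count_cat (permP h1) (permP h3) (permP sE) count_cat; clear; lia.
have pAB s1 s3 : perm_eq s1 A -> perm_eq s3 B -> perm_eq (s1 ++ s ++ s3) c.
  move=> h1 h3; apply: perm_trans (pBA s3 s1 h3 h1); apply/permP=> k.
  by rewrite !count_cat; clear; lia.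
have wA' := walk_rev e_sym wA.
have rA : perm_eq (rev A) A by rewrite perm_rev.
case: ws => ws.
- apply: (no_path (pBA B A (perm_refl _) (perm_refl _)) _ bW a'W).
    by apply: walk_cat wB (walk_cat ws wA eya) eb.
  by apply: (neq _ _ B A); rewrite ?pBA // ?(walk_head wB) ?(walk_last wA).
- apply: (no_path (pAB A B (perm_refl _) (perm_refl _)) _ aW b'W).
    by apply: walk_cat wA (walk_cat ws wB etb) eaz.
  by apply: (neq _ _ A B); rewrite ?pAB // ?(walk_head wA) ?(walk_last wB).
- apply: (no_path (pBA B (rev A) (perm_refl _) rA) _ bW aW).
    by apply: walk_cat wB (walk_cat ws wA' _) eb; rewrite e_sym.
  by apply: (neq _ _ B (rev A)); rewrite ?pBA // ?(walk_head wB) ?(walk_last wA').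
- apply: (no_path (pAB (rev A) B rA (perm_refl _)) _ a'W b'W).
    by apply: walk_cat wA' (walk_cat ws wB etb) _; rewrite e_sym.
  by apply: (neq _ _ (rev A) B); rewrite ?pAB // ?(walk_head wA') ?(walk_last wB).
Qed.

(** The cycle is opened at one vertex [w] of [W], and the remaining path is cut at the other
    vertices of [W]. *)
Lemma cycle_path_partition : {subset W <= c} -> W != set0 ->
  exists ps : seq (seq V), [/\ path_partition e ([set x in c] :\: W) ps,
    unmergeable e ps & size ps = #|W|].
Proof.
move=> Wc /set0Pn[w wW]; have [cc _] := andP c_cycle.
have [i q cE] := rot_to (Wc w wW).
have pq : perm_eq (w :: q) c by rewrite -cE perm_rot.
have uq : uniq (w :: q) by rewrite (perm_uniq pq).
pose Phi (ps : seq (seq V)) := [/\ uniq (flatten ps), {in ps, forall p, piece p} &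
  {in ps &, forall p r, p != r -> piece2 p r}].
have step l1 p1 b p2 l2 : b \in W -> Phi (l1 ++ (p1 ++ b :: p2) :: l2) ->
    Phi (l1 ++ p1 :: p2 :: l2).
  move=> bW [u h1 h2]; set P := p1 ++ b :: p2 in u h1 h2.
  have memE p : (p \in l1 ++ p1 :: p2 :: l2) = (p \in p1 :: p2 :: l1 ++ l2).
    by rewrite !(in_cons, mem_cat); case: (p == p1); case: (p == p2); rewrite ?orbT.
  have inl r : r \in l1 ++ l2 -> r \in l1 ++ P :: l2.
    by rewrite !mem_cat inE => /orP[]->; rewrite ?orbT.
  have inP : P \in l1 ++ P :: l2 by rewrite mem_cat mem_head orbT.
  have [h3 h4 h5] := piece_split bW (h1 P inP).
  have nP r : r \in l1 ++ l2 -> P != r.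
    move=> rl; apply/eqP=> rE; move: u.
    have /perm_flatten/perm_uniq-> : perm_eq (l1 ++ P :: l2) (P :: l1 ++ l2).
      by rewrite perm_catC /= perm_cons perm_catC.
    rewrite /= cat_uniq => /and3P[_ /hasP[]]; exists b.
      by apply/flattenP; exists r => //; rewrite -rE mem_cat mem_head orbT.
    by rewrite /= mem_cat mem_head orbT.
  have h6 r : r \in l1 ++ l2 -> piece2 p1 r /\ piece2 p2 r.
    by move=> rl; apply: (piece2_split bW); apply: h2 (inP) (inl r rl) (nP r rl).
  split.
  - move: u; have -> : flatten (l1 ++ P :: l2) =
        (flatten l1 ++ p1) ++ b :: (p2 ++ flatten l2) by rewrite flatten_cat /= -!catA.
    by rewrite flatten_cat /= catA !(uniq_catC (flatten l1 ++ p1)) /= => /andP[].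
  - move=> p; rewrite memE !in_cons => /or3P[/eqP->|/eqP->|pl] //.
    by apply: h1; apply: inl.
  - move=> p r; rewrite !memE !in_cons.
    case/or3P=> [/eqP->|/eqP->|pl] /or3P[/eqP->|/eqP->|rl] pr.
    + by rewrite eqxx in pr.
    + exact: h5.
    + by case: (h6 r rl).
    + exact: piece2_sym.
    + by rewrite eqxx in pr.
    + by case: (h6 r rl).
    + by apply: piece2_sym; case: (h6 p pl).
    + by apply: piece2_sym; case: (h6 p pl).
    + by apply: h2 => //; apply: inl.
have Phiq : Phi [:: q].
  split; first by rewrite /= cats0; case/andP: uq.
    move=> p; rewrite inE => /eqP->; exists [:: w]; split; rewrite /= ?wW //.
      by rewrite perm_catC.
    by apply: cycle_cat; rewrite /= -/(cycle e (w :: q)) -cE rot_cycle.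
  by move=> p r; rewrite !inE => /eqP-> /eqP->; rewrite eqxx.
have [ps [[u h1 h2] fE sE]] := split_pieces step Phiq.
rewrite /= cats0 in fE sE.
have n0 p : p \in ps -> p != [::] by move=> /h1/piece_neq0.
exists ps; split.
- split=> // [x|p pps].
    rewrite fE mem_filter !inE /=; case: (boolP (x \in W)) => //= xW.
    rewrite -(perm_mem pq) inE; case: eqVneq => [xw|//].
    by rewrite xw wW in xW.
  have [B [pE pc Bw]] := h1 p pps; have B0 : B != [::] by case: (B) Bw.
  have pB0 : p ++ B != [::] by case: (p) (n0 p pps).
  have [x [y [w' _]]] := cycle_walk pc pB0.
  by have [z [t [wp _ _]]] := walk_split w' (n0 p pps) B0; exists x, z.
- by move=> p r pp rp pr; apply: piece2_unmergeable (h2 p r pp rp pr); apply: n0.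
(* The initial piece accounts for [w], each cut for one further vertex of [W]. *)
rewrite sE -size_filter.
have -> : 1 + size (filter (mem W) q) = size (filter (mem W) (w :: q)) by rewrite /= wW.
have uW : uniq (filter (mem W) (w :: q)) by rewrite filter_uniq.
rewrite -(card_uniqP uW); apply: eq_card => x.
rewrite mem_filter (perm_mem pq) /=; case: (boolP (x \in W)) => //= xW.
by rewrite Wc.
Qed.

End CyclePieces.

(** * A longest covering cycle is spanning *)

Section LongestCycle.
Variables (V : finType) (e : rel V).
Hypotheses (e_sym : symmetric e) (e_irr : irreflexive e).
Implicit Types (x y a b : V) (s p q : seq V).

Variables (S : {set V}) (k : nat).
Hypothesis tough7 : forall X c, 1 < c -> ge_comps e c (~: X) -> 7 * c <= #|X|.
Hypothesis P4P1_free :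
  forall h (X : {set V}), {in X, forall x, (x != h) && ~~ e h x} -> P4_free e X.
Hypothesis optS : optimal_cut e S k.

Lemma exists_covering_cycle : exists c, ucycle e c /\ {subset ~: S <= c}.
Proof.
have [k1 [f [fe fk]] max] := optS; have k0 : 0 < k := ltnW k1.
(* Surplus colours are identified with 0, so that exactly [k] parts cover the complement of [S]. *)
pose g x := if f x < k then f x else 0.
apply: (@cycle_through_parts _ e e_sym e_irr S k tough7 P4P1_free optS g).
- by move=> x y xS yS exy; rewrite /g (fe x y xS yS exy).
- by move=> i ik; have [x xS fx] := fk i ik; exists x; rewrite // /g fx ik.
- by move=> x; rewrite /g; case: ifP.
Qed.

Lemma longest_cycle : exists c, [/\ ucycle e c, {subset ~: S <= c} &
  forall c', ucycle e c' -> {subset ~: S <= c'} -> size c' <= size c].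
Proof.
pose good n := `[< exists c, [/\ ucycle e c, {subset ~: S <= c} & size c = n] >].
have ex : exists n, good n.
  have [c [uc Sc]] := exists_covering_cycle.
  by exists (size c); apply/asboolP; exists c.
have bd n : good n -> n <= #|V|.
  case/asboolP=> c [/andP[_ uc] _ <-]; rewrite -(card_uniqP uc); exact: max_card.
case: (ex_maxnP ex bd) => n /asboolP[c [uc Sc sc]] max; exists c; split=> // c' uc' Sc'.
by rewrite sc; apply: max; apply/asboolP; exists c'.
Qed.

Lemma spanning_cycle : exists c, ucycle e c /\ forall x, x \in c.
Proof.
have [c [uc Sc max]] := longest_cycle; have [k1 gk maxS] := optS.
have [cc cu] := andP uc.
exists c; split=> // r; apply: contraT => rc.
pose C := [set x in c]; have CE x : (x \in C) = (x \in c) by rewrite inE.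
pose rel_out x y := [&& e x y, x \notin C & y \notin C].
have rs : symmetric rel_out by move=> x y; rewrite /rel_out e_sym [(x \notin C) && _]andbC.
pose H := [set y | connect rel_out r y].
have rH : r \in H by rewrite inE connect0.
have HC h : h \in H -> h \notin C.
  rewrite inE => /connectP[p]; elim/last_ind: p => [|p x _] /=.
    by move=> _ ->; rewrite CE.
  by rewrite rcons_path last_rcons => /andP[_ /and3P[_ _ xC]] ->.
have Hout h y : h \in H -> y \notin C -> e h y -> y \in H.
  move=> hH yC hy; have hy' : rel_out h y by rewrite /rel_out hy yC HC.
  by move: hH; rewrite !inE => rh; apply: connect_trans rh (connect1 hy').
pose W := [set w in C | [exists h in H, e w h]].
have WC : {subset W <= c} by move=> w; rewrite inE CE => /andP[].
have HW h x : h \in H -> x \notin W -> x \notin H -> ~~ e h x.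
  move=> hH xW xH; apply/negP=> hx; have [xC|xC] := boolP (x \in C).
    by case/negP: xW; rewrite inE xC; apply/exists_inP; exists h; rewrite // e_sym.
  by case/negP: xH; apply: Hout hx.
(* Such a path could be closed through a path of [H] from a neighbour of [y] to a neighbour of [x],
   giving a longer covering cycle. *)
have no_path s x y : perm_eq s c -> walk e x y s ->
    x \in W -> y \in W -> x != y -> False.
  move=> sc ws /setIdP[_ /exists_inP[hx hxH exh]] /setIdP[_ /exists_inP[hy hyH eyh]] _.
  have : connect rel_out hy hx.
    rewrite !inE in hxH hyH; apply: connect_trans hxH.
    by rewrite (sym_connect_sym rs).
  case/connectP=> p0 p0p hxE.
  case/shortenP: p0p hxE => p pp up _ hxE.
  have pH : {subset hy :: p <= H}.
    move=> z zp; have : connect rel_out hy z by apply: path_connect zp.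
    by move=> h; rewrite inE; rewrite inE in hyH; apply: connect_trans hyH h.
  have wp : walk e hy hx (hy :: p).
    by rewrite /walk eqxx hxE eqxx /=; apply: sub_path pp => u v /andP[].
  have := max (s ++ hy :: p); rewrite size_cat (perm_size sc) /= addnS ltnNge leq_addr /=.
  move=> h; suff : false by []; apply: h.
    apply/andP; split.
      by apply: walk_cycle (walk_cat ws wp eyh) _; rewrite e_sym.
    rewrite cat_uniq (perm_uniq sc) cu up andbT; apply/hasPn=> z /pH/HC.
    by rewrite CE /= (perm_mem sc).
  by move=> z /Sc zc; rewrite mem_cat (perm_mem sc) zc.
have c2 : 1 < size c.
  rewrite -(card_uniqP cu); apply: leq_trans k1 (leq_trans (ge_comps_card gk) _).
  by apply: subset_leq_card; apply/subsetP=> x /Sc.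
(* Otherwise [c] itself, opened at an edge, would be a forbidden path. The vertex [x0] makes [W] a
   genuine cut, separating it from [H]. *)
have [x0 x0C x0W] : exists2 x, x \in C & x \notin W.
  apply/subsetPn; apply/negP=> /subsetP CW.
  have [|x [y [wc _]]] := cycle_walk cc; first by case: (c) c2.
  have xW : x \in W by apply: CW; rewrite CE (walk_head wc).
  have yW : y \in W by apply: CW; rewrite CE (walk_last wc).
  apply: (no_path c x y) => //; apply/eqP=> xy; rewrite xy in wc.
  by have := walk_closed_size wc cu => s1; rewrite s1 in c2.
have H0 : H != set0 by apply/set0Pn; exists r.
have g2 : ge_comps e 2 (~: W).
  have -> : ~: W = H :|: (~: W :\: H).
    apply/setP=> x; rewrite !in_setU in_setD; case: (boolP (x \in H)) => //= xH.
    by rewrite in_setC; apply: contra (HC x xH); rewrite inE => /andP[].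
  apply: (@ge_compsU _ _ 1 1) => //.
  - by rewrite disjoint_sym disjoints_subset setDE subsetIr.
  - by move=> h x hH /setDP[xW xH]; apply: HW => //; rewrite in_setC in xW.
  - exact: ge_comps1.
  - apply: ge_comps1; apply/set0Pn; exists x0; rewrite in_setD in_setC x0W andbT.
    by apply: contraL x0C; apply: HC.
have W14 := @tough7 W 2 isT g2.
have SW : 6 + #|S| <= 3 * k + #|W| by case: (maxS W 2 isT g2) => [|[]]; lia.
have S7 := tough7 k1 gk.
have W0 : W != set0 by rewrite -card_gt0; lia.
have [ps [pp um sz]] := cycle_path_partition e_sym uc c2 no_path WC W0.
have PF : P4_free e ([set x in c] :\: W).
  apply: (P4P1_free (h := r)) => x /setDP[xc xW].
  have xH : x \notin H by apply: contraL xc; apply: HC.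
  by rewrite HW // andbT; apply: contraNneq xH => ->.
have [X XF gX] := unmergeable_scattering e_sym e_irr PF pp um.
rewrite -/C in XF gX pp; rewrite sz in gX.
(* The vertices off the cycle and outside [H] are deleted too, so that [H] is one more component;
   they all lie in [S], which [c] covers the complement of. *)
pose Z := W :|: X :|: (~: C :\: H).
have ZE : ~: Z = H :|: (C :\: W :\: X).
  apply/setP=> x; rewrite in_setC !in_setU !in_setD in_setC.
  case: (boolP (x \in H)) => xH /=.
    rewrite orbF negb_or; apply/andP; split.
      by apply: contra (HC x xH); rewrite inE => /andP[].
    by apply: contra (HC x xH) => /(subsetP XF)/setDP[].
  by case: (x \in W); case: (x \in X); case: (x \in C).
have gZ : ge_comps e (1 + (#|X| + #|W|)) (~: Z).
  rewrite ZE; apply: ge_compsU => //.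
  - rewrite disjoints_subset; apply/subsetP=> h hH; rewrite in_setC !in_setD.
    by rewrite (negPf (HC h hH)) !andbF.
  - move=> h x hH /setDP[/setDP[xC xW] _]; apply: HW => //.
    by apply: contraL xC; apply: HC.
  - exact: ge_comps1.
have cZ : #|Z| <= #|W| + #|X| + #|S|.
  have [h1 _] := leq_card_setU (W :|: X) (~: C :\: H).
  have [h2 _] := leq_card_setU W X.
  have h3 : #|~: C :\: H| <= #|S|.
    apply: subset_leq_card; apply/subsetP=> x /setDP[]; rewrite in_setC CE => xc _.
    by apply: contraNT xc => xS; apply: Sc; rewrite in_setC.
  by rewrite /Z; lia.
(* Toughness at [Z] together with [SW] gives [5 * #|S| + 43 <= 18 * k], against [7 * k <= #|S|]. *)
have := tough7 _ gZ; have lt1 : 1 < 1 + (#|X| + #|W|) by lia.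
by move=> /(_ lt1); lia.
Qed.

End LongestCycle.

(** * Toughness and induced subgraphs *)

Section ToughnessOfGraphs.
Variable G : sgraph.
Implicit Types (X : {set G}).

(** The colouring is constant on components, so each colour already occurs at the root of a
    component. *)
Lemma ge_comps_ncomponents c X : ge_comps (@adj G) c (~: X) -> c <= ncomponents_del X.
Proof.
case=> f [fe fX]; rewrite /ncomponents_del /ncomponents /n_comp_mem.
set I := induced (~: X); pose g (u : I) := f (val u).
have gc (u v : I) : connect adj u v -> g u = g v.
  case/connectP=> p; elim: p u => [|w p IH] u /=; first by move=> _ ->.
  case/andP=> uw pw vE; rewrite -(IH w pw vE).
  by apply: fe => //; apply: valP.
have -> : c = size (iota 0 c) by rewrite size_iota.
pose A := [predI roots (@adj I) & I].
rewrite -[X in _ <= X](size_image g A); apply: uniq_leq_size; first exact: iota_uniq.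
move=> i; rewrite mem_iota => /fX[x xX fx].
pose u : I := exist _ x xX; apply/mapP; exists (fingraph.root adj u).
  by rewrite mem_enum !inE andbT; apply/roots_root/sym_connect_sym/adj_sym.
by rewrite -(gc u) ?connect_root.
Qed.

Lemma tough_ge_comps (R : realType) (t : R) : tough t G ->
  forall X c, 1 < c -> ge_comps (@adj G) c (~: X) -> (t * c%:R <= #|X|%:R)%R.
Proof.
move=> tG X c c1 gc.
have nc := ge_comps_ncomponents gc.
(* Vertices of two different colours are nonadjacent, so the infinite toughness of complete graphs
   does not arise. *)
have ncG : is_complete G = false.
  case: gc => f [fe fX]; apply/negP=> /forallP cG.
  have [x xX fx] := fX 0 (ltnW c1); have [y yX fy] := fX 1 c1.
  have xy : x != y by apply/eqP=> xy; rewrite xy fy in fx.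
  have := forallP (cG x) y; rewrite xy /= => /(fe x y xX yX).
  by rewrite fx fy.
have X2 : 2 <= ncomponents_del X := leq_trans c1 nc.
have n0 : (0 < (ncomponents_del X)%:R :> R)%R by rewrite ltr0n (leq_trans _ X2).
move: tG; rewrite /tough /toughness ncG => tG.
have := le_trans tG (bigmin_le_cond _ _ X2).
(* Passing from [ncomponents_del X] down to [c] needs [t] nonnegative; for negative [t] the bound is
   trivial. *)
rewrite lee_fin ler_pdivlMr //; have [t0|t0] := leP 0%R t; last first.
  move=> _; apply: le_trans (ler0n _ _); rewrite mulr_le0_ge0 ?ler0n //; exact: ltW.
by apply: le_trans; rewrite ler_wpM2l // ler_nat.
Qed.

Lemma induced_P4_P1 (x : P4_P1 -> G) : injective x -> {mono x : u v / adj u v} ->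
  ~ induced_free P4_P1 G.
Proof.
move=> xi xm; pose A := [set x u | u in [set: P4_P1]].
move=> /(_ A); apply.
have xA (u : P4_P1) : x u \in A by apply: imset_f; rewrite inE.
pose g (u : P4_P1) : induced A := exist _ (x u) (xA u).
have inv (v : induced A) : exists u, g u = v.
  have /imsetP[u _ vE] := valP v; exists u; apply: val_inj; exact/esym.
pose f (v : induced A) := sval (cid (inv v)).
have fK : cancel f g by move=> v; apply: svalP (cid (inv v)).
have gi : injective g by move=> u v /(congr1 val) /xi.
exists f; first by exists g => // u; apply: gi; rewrite fK.
by move=> u v; rewrite -xm -[in RHS](fK u) -[in RHS](fK v).
Qed.

Lemma induced_free_P4_free : induced_free P4_P1 G ->
  forall (h : G) X, {in X, forall x, (x != h) && ~~ adj h x} -> P4_free (@adj G) X.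
Proof.
move=> free h X hX a b aX bX c d cX dX ab bc cd; apply: contraT.
rewrite !negb_or => /and3P[ac ad bd]; exfalso.
(* An induced path a b c d together with [h] would be a copy of the forbidden graph. *)
pose x (u : P4_P1) : G := match u with inl i => nth h [:: a; b; c; d] i | inr _ => h end.
have hne y : y \in X -> ~~ adj h y by move=> /hX/andP[].
have hneq y : y \in X -> (h == y) = false.
  by move=> /hX/andP[yh _]; rewrite eq_sym (negPf yh).
have neq (u v w : G) : adj u w -> ~~ adj v w -> (u == v) = false.
  by move=> uw; apply: contraNF => /eqP<-.
have irr (u v : G) : adj u v -> (u == v) = false.
  by move=> uv; apply/eqP=> uE; rewrite uE adj_irr in uv.
have ba : adj b a by rewrite adj_sym.
have cb : adj c b by rewrite adj_sym.
have dc : adj d c by rewrite adj_sym.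
have ca : ~~ adj c a by rewrite adj_sym.
have da : ~~ adj d a by rewrite adj_sym.
have db : ~~ adj d b by rewrite adj_sym.
have acE : (a == c) = false by rewrite eq_sym (neq c a d) // adj_sym.
have adE : (a == d) = false by rewrite eq_sym (neq d a c).
have bdE : (b == d) = false by rewrite (neq b d a).
have us : uniq [:: a; b; c; d; h].
  rewrite /= !inE !negb_or -!(eq_sym h) !hneq // (irr a b) // (irr b c) // (irr c d) //.
  by rewrite acE adE bdE.
(* Reading [x] off one duplicate-free list, with [h] at index 4, reduces its injectivity to that of
   the indices. *)
pose code (u : P4_P1) : nat := match u with inl i => i | inr _ => 4 end.
have xE u : x u = nth h [:: a; b; c; d; h] (code u).
  by case: u => [[[|[|[|[|]]]]]|].
apply: (@induced_P4_P1 x) free.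
  have lt_code u : code u < 5 by case: u => [[i ui]|_] //=; rewrite ltnS ltnW.
  move=> u v; rewrite !xE => /eqP; rewrite nth_uniq ?lt_code // => /eqP.
  case: u v => [[i ui]|[[|//] ui]] [[j vj]|[[|//] vj]] //= ij.
  - by congr inl; apply: val_inj.
  - by exfalso; move: ui; rewrite ij.
  - by exfalso; move: vj; rewrite -ij.
  - by congr inr; apply: val_inj.
have hN y : y \in X -> adj y h = false by move=> /hne yh; rewrite adj_sym (negPf yh).
have nh y : y \in X -> adj h y = false by move=> /hne/negPf.
by case=> [[[|[|[|[|//]]]] ui]|[[|//] ui]] [[[|[|[|[|//]]]] vi]|[[|//] vi]];
  rewrite /x /= ?adj_irr ?hN ?nh // ?ab ?bc ?cd ?ba ?cb ?dc
    ?(negPf ac) ?(negPf ad) ?(negPf bd) ?(negPf ca) ?(negPf da) ?(negPf db).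
Qed.

Lemma complete_hamiltonian : 2 < #|G| -> is_complete G -> hamiltonian G.
Proof.
move=> G3 /forallP cG; exists (enum G); split; last by move=> x; rewrite mem_enum.
  by rewrite -cardE.
rewrite /ucycle enum_uniq andbT.
have : uniq (enum G) by apply: enum_uniq.
have aG (x y : G) : x != y -> adj x y by move=> xy; have /forallP/(_ y) := cG x; rewrite xy.
have : 2 < size (enum G) by rewrite -cardE.
case: (enum G) => // x s s2 us; apply/(pathP x) => i.
rewrite size_rcons ltnS => le_is; apply: aG; rewrite -rcons_cons !nth_rcons /= ltnS le_is.
have [lt_is|] := ltnP i (size s).
  by rewrite -[nth x s i]/(nth x (x :: s) i.+1) nth_uniq //= ltn_eqF.
(* The last index is the closing edge, back to [x]. *)
move=> le_si; have -> : i = size s by apply/eqP; rewrite eqn_leq le_is.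
rewrite eqxx -[X in _ != X]/(nth x (x :: s) 0) nth_uniq //=.
by rewrite -lt0n; exact: ltnW (s2 : 1 < size s).
Qed.

End ToughnessOfGraphs.

Theorem theorem1p1 (R : realType) (G : sgraph) :
  2 < #|G| -> tough (7%:R : R) G -> induced_free P4_P1 G -> hamiltonian G.
Proof.
move=> G3 tG free.
(* An optimal cut needs two nonadjacent vertices, so complete graphs are treated apart. *)
have [cG|] := boolP (is_complete G); first exact: complete_hamiltonian.
case/forallPn=> x /forallPn[y]; rewrite negb_imply => /andP[xy nxy].
have [S [k optS]] := exists_optimal_cut (@adj_sym G) xy nxy.
have [|c [uc cG]] := spanning_cycle (@adj_sym G) (@adj_irr G) _
  (induced_free_P4_free free) optS.
  move=> X c c1 gc; have := tough_ge_comps tG c1 gc.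
  by rewrite -natrM ler_nat.
exists c; split=> //; have /andP[_ cu] := uc.
by rewrite -(card_uniqP cu); apply: leq_trans G3 (subset_leq_card _); apply/subsetP.
Qed.
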